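(* Let $k\ge3$, $1\le s\le k$, $n_1,\dots,n_k$ and $r\le\min\{n_1,\dots,n_k\}$ be positive integers. For a generic tensor $\mathcal A\in\mathbb R^{n_1}\otimes\cdots\otimes\mathbb R^{n_k}$, problem $\mathrm{mLRPOTA}(r)$ has only finitely many smooth essential KKT points, and for any positive integers $r\ge t>0$, a smooth primitive KKT point of $\mathrm{mLRPOTA}(t)$ corresponding to a smooth essential KKT point of $\mathrm{mLRPOTA}(r)$ is nondegenerate.
   Context: $\mathrm V(m,n)=\{U\in\mathbb R^{n\times m}:U^{\mathsf T}U=I_m\}$; $\mathrm B(m,n)$: $n\times m$ real matrices with unit columns; $\mathrm{OB}(m,n)$: full-column-rank elements of $\mathrm B(m,n)$. For $U=(U^{(1)},\dots,U^{(k)})$, $U^{(i)}\in\mathbb R^{n_i\times t}$ with columns $\mathbf u^{(i)}_j$, let $\lambda_j(U)=\langle\mathcal A,\mathbf u^{(1)}_j\otimes\cdots\otimes\mathbf u^{(k)}_j\rangle$, $\mathbf v^{(i)}_j\in\mathbb R^{n_i}$ the contraction of $\mathcal A$ with $\mathbf u^{(l)}_j$ for all $l\ne i$, $V^{(i)}=[\mathbf v^{(i)}_1,\dots,\mathbf v^{(i)}_t]$, $\Lambda=\operatorname{diag}(\lambda_1(U),\dots,\lambda_t(U))$. Problem $\mathrm{mLRPOTA}(t)$: maximize $\sum_{j=1}^t\lambda_j(U)^2$ over $U\in\mathrm V(t,n_1)\times\cdots\times\mathrm V(t,n_s)\times\mathrm B(t,n_{s+1})\times\cdots\times\mathrm B(t,n_k)$.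 A feasible $U$ is a KKT point iff there exist symmetric $P_i\in\mathbb R^{t\times t}$ ($i\le s$) and $\mathbf p\in\mathbb R^t$ with $V^{(i)}\Lambda=U^{(i)}P_i$ for $i\le s$ and $V^{(i)}\Lambda=U^{(i)}\operatorname{diag}(\mathbf p)$ for $i>s$. A KKT point is primitive if $\lambda_j(U)\ne0$ for all $j$. Deleting from a KKT point $U$ of $\mathrm{mLRPOTA}(r)$ the columns $j$ with $\lambda_j(U)=0$ yields a primitive KKT point of $\mathrm{mLRPOTA}(t)$ for some $t<r$ (or $U$ itself if already primitive); an essential KKT point is the set of all KKT points of $\mathrm{mLRPOTA}(r)$ yielding the same primitive KKT point. A primitive KKT point $U$ of $\mathrm{mLRPOTA}(t)$ is smooth if $U^{(i)}\in\mathrm{OB}(t,n_i)$ for all $i>s$, and an essential KKT point is smooth if its primitive KKT point is. Let $W_{\mathbf n,t,*}=\mathrm V(t,n_1)\times\cdots\times\mathrm V(t,n_s)\times\mathrm{OB}(t,n_{s+1})\times\cdots\times\mathrm{OB}(t,n_k)\times(\mathbb R\setminus\{0\})^t$ (a smooth manifold) and $g(U,\mathbf x)=\frac12\|\mathcal A-\sum_{j=1}^t x_j\mathbf u^{(1)}_j\otimes\cdots\otimes\mathbf u^{(k)}_j\|^2$ on it. A smooth primitive KKT point $U$ of $\mathrm{mLRPOTA}(t)$ is nondegenerate if $(U,(\lambda_1(U),\dots,\lambda_t(U)))$ is a nondegenerate critical point (nonsingular Hessian) of $g$ on $W_{\mathbf n,t,*}$. ''Generic'' means: outside a Lebesgue-null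 set. *)

(* Defs.v *)
From HB Require Import structures.
From mathcomp Require Import all_boot all_order all_algebra.
From mathcomp Require Import all_classical all_reals all_analysis.
Set Implicit Arguments. Unset Strict Implicit. Unset Printing Implicit Defensive.
Import Order.TTheory GRing.Theory Num.Theory.
Import numFieldNormedType.Exports.
Local Open Scope classical_set_scope.
Local Open Scope ring_scope.

Section LRPOTA.
Variable R : realType.

Definition in_box (I : finType) (a b : I -> R) (x : I -> R) : Prop :=
  forall i, a i <= x i <= b i.

Definition lebesgue_null (I : finType) (S : set (I -> R)) : Prop :=
  forall e : R, 0 < e ->
    exists a b : nat -> I -> R,
      (forall m i, a m i <= b m i) /\
      (forall x, S x -> exists m, in_box (a m) (b m) x) /\
      (forall M : nat, \sum_(m < M) \prod_(i : I) (b m i - a m i) < e).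

Fixpoint iterD (V W : normedModType R) (f : V -> W) (vs : seq V) : V -> W :=
  match vs with
  | [::] => f
  | v :: vs' => fun x => 'D_v (iterD f vs') x
  end.

Definition smooth_on (V W : normedModType R) (D : set V) (f : V -> W) : Prop :=
  forall vs : seq V,
    (forall x, D x -> forall v, derivable (iterD f vs) x v) /\
    {within D, continuous (iterD f vs)}.

Variables (k : nat) (n : 'I_k -> nat) (s : nat).

Definition MI := {dffun forall i : 'I_k, 'I_(n i)}.
Definition tensor := MI -> R.

Variable A : tensor.

Definition kpoint (t : nat) := forall i : 'I_k, 'M[R]_(n i, t).

Definition lam (t : nat) (U : kpoint t) (j : 'I_t) : R :=
  \sum_(m : MI) A m * \prod_(i < k) U i (m i) j.

Definition lamv (t : nat) (U : kpoint t) : 'rV[R]_t := \row_j lam U j.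

Definition Vmat (t : nat) (U : kpoint t) (i : 'I_k) : 'M[R]_(n i, t) :=
  \matrix_(a < n i, j < t)
     \sum_(m : MI | m i == a) A m * \prod_(l < k | l != i) U l (m l) j.

Definition Lam (t : nat) (U : kpoint t) : 'M[R]_t := diag_mx (lamv U).

Definition stiefel (m t : nat) (X : 'M[R]_(m, t)) : Prop := X^T *m X = 1%:M.
Definition unit_cols (m t : nat) (X : 'M[R]_(m, t)) : Prop :=
  forall j : 'I_t, \sum_(a < m) X a j ^+ 2 = 1.
Definition oblique (m t : nat) (X : 'M[R]_(m, t)) : Prop :=
  unit_cols X /\ \rank X = t.

(* feasible set of mLRPOTA(t): factors 1..s (indices i < s here, 0-based)
   Stiefel, factors s+1..k unit columns *)
Definition feasible (t : nat) (U : kpoint t) : Prop :=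
  (forall i : 'I_k, (i < s)%N -> stiefel (U i)) /\
  (forall i : 'I_k, (s <= i)%N -> unit_cols (U i)).

Definition KKT (t : nat) (U : kpoint t) : Prop :=
  feasible U /\
  (exists P : forall i : 'I_k, 'M[R]_t,
      forall i : 'I_k, (i < s)%N ->
        (P i)^T = P i /\ Vmat U i *m Lam U = U i *m P i) /\
  (exists p : 'rV[R]_t,
      forall i : 'I_k, (s <= i)%N -> Vmat U i *m Lam U = U i *m diag_mx p).

Definition primitive (t : nat) (U : kpoint t) : Prop :=
  forall j : 'I_t, lam U j != 0.

Definition smooth_pt (t : nat) (U : kpoint t) : Prop :=
  forall i : 'I_k, (s <= i)%N -> oblique (U i).

Definition nzcols (t : nat) (U : kpoint t) : {set 'I_t} :=
  [set j | lam U j != 0].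

Definition reduce (t : nat) (U : kpoint t) : {t' : nat & kpoint t'} :=
  existT kpoint #|nzcols U|
    (fun i => colsub (fun j : 'I_#|nzcols U| => enum_val j) (U i)).

(* the set of (primitive KKT points representing) smooth essential KKT
   points of mLRPOTA(r) *)
Definition smooth_essential (r : nat) : set {t : nat & kpoint t} :=
  [set P | exists U : kpoint r, KKT U /\ reduce U = P /\ smooth_pt (projT2 P)].

Definition inW (t : nat) (U : kpoint t) (x : 'rV[R]_t) : Prop :=
  (forall i : 'I_k, (i < s)%N -> stiefel (U i)) /\
  (forall i : 'I_k, (s <= i)%N -> oblique (U i)) /\
  (forall j : 'I_t, x 0 j != 0).

Definition gfun (t : nat) (U : kpoint t) (x : 'rV[R]_t) : R :=
  2^-1 * \sum_(m : MI)
     (A m - \sum_(j < t) x 0 j * \prod_(i < k) U i (m i) j) ^+ 2.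

Definition evec (d : nat) (a : 'I_d) : 'rV[R]_d := delta_mx 0 a.

(* a smooth local parametrization (inverse of a chart) of W_{n,t,*}
   around (U, x): defined on the open ball of radius delta around 0 *)
Definition local_param (t : nat) (U : kpoint t) (x : 'rV[R]_t) (d : nat)
  (delta : R) (phiU : forall i : 'I_k, 'rV[R]_d -> 'M[R]_(n i, t))
  (phix : 'rV[R]_d -> 'rV[R]_t) : Prop :=
  let D := ball (0 : 'rV[R]_d) delta in
  0 < delta /\
  (forall i, phiU i 0 = U i) /\ phix 0 = x /\
  (forall y, D y -> inW (fun i => phiU i y) (phix y)) /\
  (forall y y', D y -> D y' -> (forall i, phiU i y = phiU i y') ->
      phix y = phix y' -> y = y') /\
  (exists e : R, 0 < e /\
     forall (U' : kpoint t) (x' : 'rV[R]_t), inW U' x' ->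
       (forall i, `|U' i - U i| < e) -> `|x' - x| < e ->
       exists y, D y /\ (forall i, phiU i y = U' i) /\ phix y = x') /\
  (forall y, D y -> forall e : R, 0 < e -> exists eta : R, 0 < eta /\
     forall y', D y' -> (forall i, `|phiU i y' - phiU i y| < eta) ->
       `|phix y' - phix y| < eta -> `|y' - y| < e) /\
  (forall i, smooth_on D (phiU i)) /\ smooth_on D phix /\
  (forall c : 'rV[R]_d,
     (forall i, \sum_(a < d) c 0 a *: 'D_(evec a) (phiU i) 0 = 0) ->
     \sum_(a < d) c 0 a *: 'D_(evec a) phix 0 = 0 -> c = 0).

Definition nondeg_critical (t : nat) (U : kpoint t) (x : 'rV[R]_t) : Prop :=
  inW U x /\
  exists (d : nat) (delta : R) (phiU : forall i : 'I_k, 'rV[R]_d -> 'M[R]_(n i, t))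
         (phix : 'rV[R]_d -> 'rV[R]_t),
    local_param U x delta phiU phix /\
    let G := fun y : 'rV[R]_d => gfun (fun i => phiU i y) (phix y) in
    (forall a : 'I_d, 'D_(evec a) G 0 = 0) /\
    (\matrix_(a < d, b < d) 'D_(evec a) ('D_(evec b) G) 0) \in unitmx.

Definition nondegenerate_kkt (t : nat) (U : kpoint t) : Prop :=
  nondeg_critical U (lamv U).

End LRPOTA.

(* Main.v *)
(** The critical points of [g] on [W] are the points where [A - F] is orthogonal to the tangent
    space, [F] being the sum of rank-one tensors.  [W] is covered by finitely many rational charts
    (Cayley transforms, one for each choice of signs), and since [k >= 3] and the factors have full
    column rank, [F] is an immersion.  Hence the pairs (chart parameter [z], critical datum [A])
    are locally parametrized by rational functions of [N] variables, where [N] is the dimension of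
    the tensor space, so each coordinate of [z] is algebraic over the [N] entries of [A]: it is a
    root of a polynomial [P] whose coefficients are polynomials in [A].  Off the zero set of one
    nonzero polynomial in [A], which is a null set, [P(A, _)] is nonzero and may be replaced by a
    polynomial that has these roots as simple roots.  Finitely many roots give finitely many
    critical points.  If [v] is in the kernel of the Hessian, the pair [(z, A)] can move to first
    order with [z' = v] and [A' = 0]; differentiating [P(A, z_i) = 0] at a simple root gives
    [v_i = 0]. *)
Require Import Defs.
From HB Require Import structures.
From mathcomp Require Import all_boot all_order all_algebra.
From mathcomp Require Import all_classical all_reals all_analysis.
From mathcomp Require Import zify ring lra.
From mathcomp Require mpoly.
Import -(notations) mpoly.
Import Order.TTheory GRing.Theory Num.Theory.
Local Open Scope classical_set_scope.
Local Open Scope ring_scope.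

Set Implicit Arguments.
Unset Strict Implicit.
Unset Printing Implicit Defensive.
Import numFieldNormedType.Exports.

(** * Rational functions *)

(** The number [N] of variables is no accident: the pairs (point, datum) form the normal bundle of
    the immersed image, with [d] parameters for the point and [N - d] for the normal residual. One
    coordinate of [z] and the [N] entries of [A] are thus [N + 1] rational functions of [N]
    variables, and counting monomials forces a relation. A relation gives finiteness as well as
    nondegeneracy, and its exceptional set is the zero set of a polynomial, whose nullness can be
    checked with explicit boxes.

    The charts are rational with a rational inverse. This makes the data algebraic, and it also
    yields injectivity, immersion and continuity of the inverse directly from the inverse.

    A relation over the ring of polynomials in [A] is useful at a given [A] only if it survives
    specialization with simple roots. The scalars produced by pseudo-division and the leading
    coefficient are what has to stay nonzero for this.

    The passage from KKT points to critical points rests on [s >= 1]: one orthonormal factor removes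
    the cross terms between different summands, and then the weights [x = lamv A U] are
    stationary. *)

Section RationalFunctions.
Variables (R : realType) (p q : nat).
Implicit Types (D : set 'M[R]_(p, q)) (f g : 'M[R]_(p, q) -> R).

(** These are expression trees in which only functions without zeros on [D] are inverted.
    Differentiability at points of [D], stability under derivatives and representation as a fraction
    all follow by induction on the tree; values outside [D] carry no information. *)
Inductive ratfun D : ('M[R]_(p, q) -> R) -> Prop :=
| ratfun_cst c : ratfun D (fun _ => c)
| ratfun_coord i j : ratfun D (fun X => X i j)
| ratfunD f g : ratfun D f -> ratfun D g -> ratfun D (fun X => f X + g X)
| ratfunM f g : ratfun D f -> ratfun D g -> ratfun D (fun X => f X * g X)
| ratfunV f : (forall X, D X -> f X != 0) -> ratfun D f ->
    ratfun D (fun X => (f X)^-1).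

Lemma ratfunN D f : ratfun D f -> ratfun D (fun X => - f X).
Proof.
move=> hf; have -> : (fun X => - f X) = (fun X => -1 * f X).
  by apply/funext => X; rewrite mulN1r.
by apply: ratfunM hf; apply: ratfun_cst.
Qed.

Lemma ratfunB D f g : ratfun D f -> ratfun D g -> ratfun D (fun X => f X - g X).
Proof. by move=> hf hg; apply: (@ratfunD _ _ (fun X => - g X)) => //; apply: ratfunN. Qed.

Lemma ratfunX D f m : ratfun D f -> ratfun D (fun X => f X ^+ m).
Proof.
move=> hf; elim: m => [|m IH].
  have -> : (fun X => f X ^+ 0) = (fun _ => 1) by apply/funext => X; rewrite expr0.
  exact: ratfun_cst.
have -> : (fun X => f X ^+ m.+1) = (fun X => f X * f X ^+ m).
  by apply/funext => X; rewrite exprS.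
exact: ratfunM.
Qed.

Lemma ratfun_sum D (I : Type) (r : seq I) (P : pred I) (F : I -> 'M[R]_(p, q) -> R) :
  (forall i, P i -> ratfun D (F i)) ->
  ratfun D (fun X => \sum_(i <- r | P i) F i X).
Proof.
move=> hF; elim: r => [|i r IH].
  have -> : (fun X => \sum_(i <- [::] | P i) F i X) = (fun _ => 0).
    by apply/funext => X; rewrite big_nil.
  exact: ratfun_cst.
have -> : (fun X => \sum_(j <- i :: r | P j) F j X) =
  (if P i then fun X => F i X + \sum_(j <- r | P j) F j X
   else fun X => \sum_(j <- r | P j) F j X).
  by apply/funext => X; rewrite big_cons; case: (P i).
by case: (boolP (P i)) => // Pi; apply: ratfunD => //; apply: hF.
Qed.

Lemma ratfun_prod D (I : Type) (r : seq I) (P : pred I) (F : I -> 'M[R]_(p, q) -> R) :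
  (forall i, P i -> ratfun D (F i)) ->
  ratfun D (fun X => \prod_(i <- r | P i) F i X).
Proof.
move=> hF; elim: r => [|i r IH].
  have -> : (fun X => \prod_(i <- [::] | P i) F i X) = (fun _ => 1).
    by apply/funext => X; rewrite big_nil.
  exact: ratfun_cst.
have -> : (fun X => \prod_(j <- i :: r | P j) F j X) =
  (if P i then fun X => F i X * \prod_(j <- r | P j) F j X
   else fun X => \prod_(j <- r | P j) F j X).
  by apply/funext => X; rewrite big_cons; case: (P i).
by case: (boolP (P i)) => // Pi; apply: ratfunM => //; apply: hF.
Qed.

Lemma ratfun_differentiable D f X : ratfun D f -> D X -> differentiable f X.
Proof.
move=> hf DX; elim: hf => [c|i j|{}f g _ df _ dg|{}f g _ df _ dg|{}f f0 _ df].
- exact: differentiable_cst.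
- exact: differentiable_coord.
- exact: differentiableD.
- exact: differentiableM.
- by apply: differentiableV => //; exact: f0.
Qed.

Lemma ratfun_derivable D f X v : ratfun D f -> D X -> derivable f X v.
Proof. by move=> hf DX; apply: diff_derivable; apply: ratfun_differentiable hf DX. Qed.

Lemma ratfun_continuous D f X : ratfun D f -> D X -> {for X, continuous f}.
Proof.
by move=> hf DX; apply: differentiable_continuous; apply: ratfun_differentiable hf DX.
Qed.

Lemma ratfun_derive D f v : ratfun D f ->
  exists2 g, ratfun D g & forall X, D X -> 'D_v f X = g X.
Proof.
elim=> [c|i j|{}f g hf [f' hf' ef] hg [g' hg' eg]|{}f g hf [f' hf' ef] hg [g' hg' eg]
       |{}f f0 hf [f' hf' ef]].
- by exists (fun _ => 0); [exact: ratfun_cst | move=> X _; rewrite derive_cst].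
- exists (fun _ => v i j); first exact: ratfun_cst.
  move=> X _; have := derive_mx (@derivable_id R 'M[R]_(p, q) X v).
  rewrite derive_id => /matrixP/(_ i j).
  by rewrite mxE.
- exists (fun X => f' X + g' X); first exact: ratfunD.
  move=> X DX; rewrite -ef // -eg // -deriveD //; exact: ratfun_derivable DX.
- exists (fun X => f X * g' X + g X * f' X).
    by apply: ratfunD; apply: ratfunM.
  move=> X DX; rewrite -ef // -eg //.
  by rewrite (@deriveM _ _ f g) //; exact: ratfun_derivable DX.
- exists (fun X => - (f X ^- 2) * f' X).
    apply: ratfunM => //; apply: ratfunN; apply: ratfunV => [X DX|].
      by rewrite expf_neq0 // f0.
    exact: ratfunX.
  move=> X DX; rewrite -ef // (@deriveV _ _ f) //; [exact: f0|exact: ratfun_derivable DX].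
Qed.

Lemma ratfun_deriveT f v : ratfun setT f -> ratfun setT ('D_v f).
Proof.
move=> /(ratfun_derive v)[g hg e].
by have -> : 'D_v f = g by apply/funext => X; exact: e.
Qed.

Lemma ratfun_derive_linear D f X (I : finType) (c : I -> R) (e : I -> 'M[R]_(p, q)) :
  ratfun D f -> D X -> 'D_(\sum_i c i *: e i) f X = \sum_i c i * 'D_(e i) f X.
Proof.
move=> hf DX; have df := ratfun_differentiable hf DX.
rewrite deriveE // linear_sum; apply: eq_bigr => i _.
by rewrite linearZ /= deriveE.
Qed.

Lemma ratfun_det D m (F : 'M[R]_(p, q) -> 'M[R]_m) :
  (forall i j, ratfun D (fun X => F X i j)) -> ratfun D (fun X => \det (F X)).
Proof.
move=> hF; rewrite /determinant; apply: ratfun_sum => s _.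
apply: ratfunM; first exact: ratfun_cst.
by apply: ratfun_prod => i _.
Qed.

Lemma ratfun_adj D m (F : 'M[R]_(p, q) -> 'M[R]_m) i j :
  (forall i j, ratfun D (fun X => F X i j)) -> ratfun D (fun X => (\adj (F X)) i j).
Proof.
move=> hF.
have -> : (fun X => \adj (F X) i j) = (fun X => cofactor (F X) j i).
  by apply/funext => X; rewrite mxE.
apply: ratfunM; first exact: ratfun_cst.
apply: ratfun_det => a b.
have -> : (fun X => row' j (col' i (F X)) a b) = (fun X => F X (lift j a) (lift i b)).
  by apply/funext => X; rewrite !mxE.
exact: hF.
Qed.

Lemma ratfun_mulmx D a b c (F : 'M[R]_(p, q) -> 'M[R]_(a, b))
    (G : 'M[R]_(p, q) -> 'M[R]_(b, c)) i j :
  (forall i j, ratfun D (fun X => F X i j)) -> (forall i j, ratfun D (fun X => G X i j)) ->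
  ratfun D (fun X => (F X *m G X) i j).
Proof.
move=> hF hG.
have -> : (fun X => (F X *m G X) i j) = (fun X => \sum_k F X i k * G X k j).
  by apply/funext => X; rewrite mxE.
by apply: ratfun_sum => k _; apply: ratfunM.
Qed.

(** Case of the chain rule in which the inner map is stationary, so each formation rule preserves
    the derivative [0] and no formula for the derivative of [f] appears. It serves for left inverses
    of charts and for polynomials in stationary data. *)
Lemma ratfun_chain0 (V : normedModType R) D f (h : V -> 'M[R]_(p, q)) x v :
  ratfun D f -> D (h x) -> (forall i j, is_derive x v (fun y => h y i j) 0) ->
  is_derive x v (fun y => f (h y)) 0.
Proof.
move=> hf Dh dh; elim: hf => [c|i j|{}f g _ df _ dg|{}f g _ df _ dg|{}f f0 _ df].
- exact: is_derive_cst.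
- exact: dh.
- by have := @is_deriveD _ _ _ _ _ _ _ _ _ df dg; rewrite addr0.
- by have := @is_deriveM _ _ _ _ _ _ _ _ df dg; rewrite !scaler0 addr0.
- have h0 := f0 _ Dh.
  apply: DeriveDef.
    by apply: (@derivableV _ _ (f \o h)) => //; apply: ex_derive.
  rewrite (@deriveV _ _ (f \o h)) //; first by rewrite derive_val scaler0.
Qed.

End RationalFunctions.

Lemma ratfun_comp (R : realType) (p q p' q' : nat) (D : set 'M[R]_(p, q))
    (D' : set 'M[R]_(p', q')) f (h : 'M[R]_(p', q') -> 'M[R]_(p, q)) :
  ratfun D f -> (forall i j, ratfun D' (fun Y => h Y i j)) ->
  (forall Y, D' Y -> D (h Y)) -> ratfun D' (fun Y => f (h Y)).
Proof.
move=> hf hh hD; elim: hf => [c|i j|{}f g _ df _ dg|{}f g _ df _ dg|{}f f0 _ df].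
- exact: ratfun_cst.
- exact: hh.
- exact: ratfunD.
- exact: ratfunM.
- by apply: ratfunV => // Y /hD; exact: f0.
Qed.

Lemma ratfun_modulus (R : realType) (p q : nat) (D : set 'M[R]_(p, q)) f X (e : R) :
  ratfun D f -> D X -> 0 < e -> exists2 d : R, 0 < d &
    forall Y : 'M[R]_(p, q), (forall i j, `|Y i j - X i j| < d) -> `|f Y - f X| < e.
Proof.
move=> hf DX e0; have := ratfun_continuous hf DX.
move/cvgrPdist_lt => /(_ e e0) /nbhs_ballP[d /= d0 h].
exists d => // Y hY; rewrite distrC; apply: h; split=> // i j.
by rewrite /ball /= distrC.
Qed.

(** * Algebraic dependence *)

Section AlgebraicDependence.
Variables (R : fieldType) (N : nat).
Implicit Types p q : mpoly N R.

(** [mmeasure mdeg] is the degree plus one, and [0] at the zero polynomial. Bounds of the form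
    [B.+1] make degrees add up and also cover the zero polynomial. *)
Lemma msizeM_leD p q B C :
  (mmeasure mdeg p <= B.+1)%N -> (mmeasure mdeg q <= C.+1)%N ->
  (mmeasure mdeg (p * q) <= (B + C).+1)%N.
Proof.
have [->|p0] := eqVneq p 0; first by rewrite mul0r msize0.
have [->|q0] := eqVneq q 0; first by rewrite mulr0 msize0.
move=> hp hq; rewrite msizeM //.
have := leq_add hp hq; rewrite addSn addnS.
by case: (_ + _)%N => //.
Qed.

Lemma msize_prod_le (I : finType) (P : I -> mpoly N R) (B : I -> nat) :
  (forall i, mmeasure mdeg (P i) <= (B i).+1)%N ->
  (mmeasure mdeg (\prod_i P i) <= (\sum_i B i).+1)%N.
Proof.
move=> h; apply: (big_ind2 (fun (p : mpoly N R) b => mmeasure mdeg p <= b.+1)%N) => //.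
  by rewrite msize1.
by move=> p b p' b' *; exact: msizeM_leD.
Qed.

Lemma msizeX_le p B k : (mmeasure mdeg p <= B.+1)%N ->
  (mmeasure mdeg (p ^+ k) <= (B * k).+1)%N.
Proof.
move=> h; elim: k => [|k IH]; first by rewrite expr0 msize1.
by rewrite exprS mulnS; apply: msizeM_leD.
Qed.

(** Monomials of degree at most [B] lie in the box of exponents at most [B]. Counting the whole box
    is crude, but [B.+1 ^ N] has the right order of growth for the dimension count. *)
Lemma mcoeff_vanish p B (c : {ffun 'I_N -> 'I_B.+1} -> multinom N) :
  (forall b i, c b i = b i) ->
  (mmeasure mdeg p <= B.+1)%N -> (forall b, mcoeff (c b) p = 0) -> p = 0.
Proof.
move=> hc hp h; apply/mpolyP => m; rewrite mcoeff0.
have [hm|hm] := boolP (m \in msupp p); last by exact: memN_msupp_eq0.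
have lt i : (m i < B.+1)%N.
  apply: leq_trans (leq_trans (msize_mdeg_lt hm) hp).
  by rewrite ltnS mdegE (bigD1 i) //= leq_addr.
rewrite -(h [ffun i => Ordinal (lt i)]); congr mcoeff; apply/mnmP => i.
by rewrite hc ffunE.
Qed.

Lemma row_dependent m n (A : 'M[R]_(m, n)) : (n < m)%N ->
  exists2 c : 'rV[R]_m, c != 0 & c *m A = 0.
Proof.
move=> nm; have : kermx A != 0.
  rewrite kermx_eq0 /row_free neq_ltn (leq_ltn_trans _ nm) //.
  exact: rank_leq_col.
case/rowV0Pn => c cK c0; exists c => //.
exact/sub_kermxP.
Qed.

(* Dimension count: the [D.+1 ^ #|I|] products outnumber the monomials in [N] variables of degree
   linear in [D]. *)
Lemma dependent_products (I : finType) (p : I -> mpoly N R) q : (N < #|I|)%N ->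
  exists D (c : {ffun I -> 'I_D.+1} -> R), (exists a, c a != 0) /\
    \sum_a c a *: \prod_i (p i ^+ a i * q ^+ (D - a i)) = 0.
Proof.
move=> hN.
pose K := ((\sum_i mmeasure mdeg (p i)) + mmeasure mdeg q)%N.
have Kp i : (mmeasure mdeg (p i) <= K.+1)%N.
  by rewrite /K (bigD1 i) //= -!addnA; lia.
have Kq : (mmeasure mdeg q <= K.+1)%N by rewrite /K; lia.
(* The products have degree at most [B = #|I| K D], and [B + 1 <= (D + 1)(#|I| K + 1)]. With this
   [D], [(B + 1)^N <= (D + 1)^N D < (D + 1)^(N + 1)], which is at most the number of products. *)
pose D := ((#|I| * K).+1 ^ N)%N.
pose B := (#|I| * (K * D))%N.
pose h (a : {ffun I -> 'I_D.+1}) := \prod_i (p i ^+ a i * q ^+ (D - a i)).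
have hh a : (mmeasure mdeg (h a) <= B.+1)%N.
  have := @msize_prod_le I (fun i => p i ^+ a i * q ^+ (D - a i)) (fun _ => K * D)%N.
  rewrite sum_nat_const; apply => i.
  have aD : (a i <= D)%N by rewrite -ltnS.
  have -> : (K * D = K * a i + K * (D - a i))%N by rewrite -mulnDr subnKC.
  by apply: msizeM_leD; apply: msizeX_le.
pose T := {ffun I -> 'I_D.+1}; pose T' := {ffun 'I_N -> 'I_B.+1}.
pose mon (b : T') : multinom N := Multinom [tuple (b i : nat) | i < N].
have monE b i : mon b i = b i by rewrite mnmE.
have cT : (#|T'| < #|T|)%N.
  rewrite !card_ffun !card_ord.
  have B1 : (B.+1 <= D.+1 * (#|I| * K).+1)%N.
    by rewrite /B; nia.
  apply: (@leq_ltn_trans ((D.+1 * (#|I| * K).+1) ^ N)%N).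
    by case: (posnP N) => [->//|N0]; rewrite leq_exp2r.
  rewrite expnMn -/D; apply: (@leq_trans (D.+1 ^ N.+1)%N).
    by rewrite expnSr ltn_pmul2l // expn_gt0.
  by rewrite leq_exp2l // /D ltnS expn_gt0.
pose M := \matrix_(x < #|T|, y < #|T'|) mcoeff (mon (enum_val y)) (h (enum_val x)).
have [c c0 cM] := row_dependent M cT.
exists D, (fun a => c 0 (enum_rank a)); split.
  case/rV0Pn: c0 => x cx; exists (enum_val x); by rewrite enum_valK.
apply: (mcoeff_vanish (c := mon)) => //.
  apply: leq_trans (msize_sum _ _ _) _; apply/bigmax_leqP => a _.
  by apply: leq_trans (msizeZ_le _ _) _; exact: hh.
move=> b; rewrite raddf_sum /=.
transitivity ((c *m M) 0 (enum_rank b)); last by rewrite cM mxE.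
rewrite mxE.
rewrite (reindex_onto (@enum_val T predT) enum_rank); last by move=> *; exact: enum_rankK.
rewrite (eq_bigl predT) => [|x]; last by rewrite enum_valK eqxx.
by apply: eq_bigr => x _; rewrite mcoeffZ !mxE enum_valK enum_rankK.
Qed.

End AlgebraicDependence.

Section EvaluatedDependence.
Variables (R : realType) (N : nat).

Lemma ratfun_fraction (D : set 'rV[R]_N) f : ratfun D f ->
  exists p q : mpoly N R, forall w, D w ->
    meval (w 0) q != 0 /\ f w = meval (w 0) p / meval (w 0) q.
Proof.
elim=> [c|i j|{}f g _ [p [q h]] _ [p' [q' h']]|{}f g _ [p [q h]] _ [p' [q' h']]
       |{}f f0 _ [p [q h]]].
- by exists (mpolyC N c), 1 => w _; rewrite mevalC meval1 divr1 oner_neq0.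
- exists (mpolyX R (mnm1 j)), 1 => w _.
  by rewrite mevalXU meval1 divr1 oner_neq0 ord1.
- exists (p * q' + p' * q), (q * q') => w Dw.
  have [q0 ->] := h w Dw; have [q0' ->] := h' w Dw.
  by rewrite mevalD !mevalM mulf_neq0 // addf_div.
- exists (p * p'), (q * q') => w Dw.
  have [q0 ->] := h w Dw; have [q0' ->] := h' w Dw.
  by rewrite !mevalM mulf_neq0 // mulf_div.
- exists q, p => w Dw; have [q0 e] := h w Dw.
  have p0 : meval (w 0) p != 0.
    by apply: contra_neq (f0 w Dw) => p0; rewrite e p0 mul0r.
  by rewrite e invf_div.
Qed.

Definition eval_coefs (y : 'I_N -> R) (P : {poly (mpoly N R)}) : {poly R} :=
  map_poly (meval y) P.

(** Over a common denominator [q], the functions [g] and [A m] become [p i / q], and they are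
    [N + 1] in number. A linear relation among the homogenized products, divided by a power of [q],
    is a polynomial relation; the exponent of [g] becomes the power of the polynomial variable and
    the other exponents form the coefficient monomial. *)
Lemma ratfun_dependent (D : set 'rV[R]_N) (g : 'rV[R]_N -> R) (A : 'I_N -> 'rV[R]_N -> R) :
  ratfun D g -> (forall m, ratfun D (A m)) ->
  exists2 P : {poly (mpoly N R)}, P != 0 &
    forall w, D w -> (eval_coefs (fun m => A m w) P).[g w] = 0.
Proof.
move=> hg hA.
pose F (i : option 'I_N) := if i is Some m then A m else g.
have hF i : ratfun D (F i) by case: i.
have /choice[pq hpq] : forall i, exists r : mpoly N R * mpoly N R, forall w, D w ->
    meval (w 0) r.2 != 0 /\ F i w = meval (w 0) r.1 / meval (w 0) r.2.
  by move=> i; have [p [q h]] := ratfun_fraction (hF i); exists (p, q).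
pose q := \prod_i (pq i).2.
pose p i := (pq i).1 * \prod_(j | j != i) (pq j).2.
have q0 w : D w -> meval (w 0) q != 0.
  by move=> Dw; rewrite rmorph_prod /=; apply/prodf_neq0 => i _; case: (hpq i w Dw).
have Fpq i w : D w -> F i w = meval (w 0) (p i) / meval (w 0) q.
  move=> Dw; have [r0 ->] := hpq i w Dw.
  rewrite /q (bigD1 i) //= /p !mevalM -mulf_div divff ?mulr1 //.
  by rewrite rmorph_prod; apply/prodf_neq0 => j _; case: (hpq j w Dw).
have [|d [c [[a0 ca0] hc]]] := @dependent_products _ N _ p q.
  by rewrite card_option card_ord.
pose mon (a : {ffun option 'I_N -> 'I_d.+1}) : multinom N :=
  Multinom [tuple (a (Some i) : nat) | i < N].
pose P : {poly (mpoly N R)} := \sum_a (c a *: mpolyX R (mon a)) *: 'X^(a None).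
exists P.
  (* [a] is determined by [mon a] and [a None], so no other term contributes to the coefficient
     selected by [a0], which is [c a0]. *)
  apply/eqP => /(congr1 (fun Q : {poly (mpoly N R)} => mcoeff (mon a0) Q`_(a0 None))).
  rewrite coef0 mcoeff0 coef_sum raddf_sum (bigD1 a0) //= big1 => [|a aa0].
    rewrite coefZ coefXn eqxx mulr1 mcoeffZ mcoeffX eqxx mulr1 addr0.
    by apply/eqP.
  rewrite coefZ coefXn; case: eqP => [e0|_]; last by rewrite mulr0 mcoeff0.
  rewrite mulr1 mcoeffZ mcoeffX; case: eqP => [/mnmP e1|_]; last by rewrite mulr0.
  case/eqP: aa0; apply/ffunP => -[i|]; last exact/val_inj.
  by apply/val_inj; have := e1 i; rewrite !mnmE.
move=> w Dw.
have /(congr1 (meval (w 0))) := hc.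
rewrite meval0 raddf_sum /= => E.
have Q0 : (meval (w 0) q) ^+ (d * #|{: option 'I_N}|) != 0.
  by rewrite expf_neq0 // q0.
apply/eqP; rewrite -(mulrI_eq0 _ (mulfI Q0)) mulrC -E; apply/eqP.
rewrite /eval_coefs raddf_sum horner_sum mulr_suml; apply: eq_bigr => a _ /=.
rewrite linearZ_LR /= map_polyXn hornerZ hornerXn !mevalZ mevalX [in RHS]rmorph_prod /= -!mulrA.
congr (_ * _).
transitivity (\prod_i (F i w ^+ a i * meval (w 0) q ^+ d)).
  rewrite big_split /= prodr_const -exprM mulrA; congr (_ * _).
  rewrite [RHS](bigD1 None) //= mulrC; congr (_ * _).
  rewrite (reindex_omap Some id) => [|[] //].
  by apply: eq_big => [i|i _]; rewrite ?eqxx // mnmE.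
apply: eq_bigr => i _; rewrite mevalM !rmorphXn /=.
have aD : (a i <= d)%N by rewrite -ltnS.
have hq := q0 w Dw.
have -> : meval (w 0) q ^+ d = meval (w 0) q ^+ a i * meval (w 0) q ^+ (d - a i).
  by rewrite -exprD subnKC.
rewrite (Fpq i w Dw) expr_div_n.
by rewrite mulrA divfK // expf_neq0.
Qed.

End EvaluatedDependence.

(* [D] plays the role of [gcd (p, p^`())], so that [Q] is the squarefree part of [p]. *)
Lemma squarefree_part_simple_root (R : numFieldType) (p Q D W u v : {poly R}) (c1 c2 b1 b2 t : R) :
  p != 0 -> c1 != 0 -> c2 != 0 -> b2 != 0 ->
  c1 *: p = Q * D -> c2 *: p^`() = W * D -> b1 *: (u * p + v * p^`()) = b2 *: D ->
  root p t -> root Q t && (Q^`().[t] != 0).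
Proof.
move=> p0 c10 c20 b20 eQ eW eD rt.
have [m [r]] := multiplicity_XsubC p t; rewrite p0 /= => rt0 ep.
have m0 : (0 < m)%N.
  by case: m ep => // ep; rewrite ep expr0 mulr1 in rt; rewrite rt in rt0.
pose x := 'X - t%:P; have x0 : x ^+ m.-1 != 0 by rewrite expf_neq0 // polyXsubC_eq0.
have ep1 : p = x ^+ m.-1 * (x * r) by rewrite mulrA -exprSr prednK // mulrC ep.
have edp : p^`() = x ^+ m.-1 * (r *+ m + x * r^`()).
  rewrite ep derivM deriv_exp derivXsubC mul1r -/x.
  have -> : x ^+ m = x ^+ m.-1 * x by rewrite -exprSr prednK.
  by rewrite -[_ *+ m]mulr_natl -[r *+ m]mulr_natl; ring.
(* The Bezout relation transfers to [D] the factor [x ^+ m.-1] common to [p] and its derivative. *)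
have [D1 eD1] : exists D1, D = x ^+ m.-1 * D1.
  exists (b2^-1 *: (b1 *: (u * (x * r) + v * (r *+ m + x * r^`())))).
  apply: (scalerI b20); rewrite -eD edp ep1 -!scalerAr !scalerA mulVKf //.
  by congr (_ *: _); ring.
have eQ1 : c1 *: (x * r) = Q * D1.
  by apply: (mulfI x0); rewrite -scalerAr -ep1 eQ [RHS]mulrCA -eD1.
have eW1 : c2 *: (r *+ m + x * r^`()) = W * D1.
  by apply: (mulfI x0); rewrite -scalerAr -edp eW [RHS]mulrCA -eD1.
have xt : x.[t] = 0 by rewrite hornerXsubC subrr.
have rt1 : r.[t] != 0 by [].
(* At [t] the cofactor of the derivative takes the value [m r(t)], nonzero in characteristic zero.
   So [D] has multiplicity exactly [m - 1] at [t], which leaves multiplicity one for [Q]. *)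
have D1t : D1.[t] != 0.
  have : (c2 *: (r *+ m + x * r^`())).[t] != 0.
    rewrite hornerZ hornerD hornerM xt mul0r addr0 hornerMn mulf_neq0 //.
    by rewrite mulrn_eq0 negb_or rt1 -lt0n m0.
  by rewrite eW1 hornerM mulf_eq0 negb_or => /andP[].
have Qt : Q.[t] = 0.
  have : (c1 *: (x * r)).[t] = 0 by rewrite hornerZ hornerM xt mul0r mulr0.
  by rewrite eQ1 hornerM => /eqP; rewrite mulf_eq0 (negbTE D1t) orbF => /eqP.
rewrite /root Qt eqxx /=.
have /(congr1 (fun s => s^`().[t])) := eQ1.
rewrite derivZ !derivM derivXsubC mul1r hornerZ !hornerD !hornerM xt mul0r addr0 Qt mul0r addr0 => E.
have : c1 * r.[t] != 0 by rewrite mulf_neq0.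
by rewrite E mulf_eq0 negb_or => /andP[].
Qed.

(** Over a domain, gcd, division and Bezout hold up to scalars [c1], [c2], [b2]. Where these and the
    leading coefficient of [P] do not vanish, the identities specialize to those that make the roots
    of [P] simple roots of [Q]; hence [c] is their product. *)
Lemma generic_simple_roots (R : realType) (N : nat) (P : {poly (mpoly N R)}) : P != 0 ->
  exists (c : mpoly N R) (Q : {poly (mpoly N R)}), c != 0 /\
    forall y t, meval y c != 0 -> (eval_coefs y P).[t] = 0 ->
      [/\ eval_coefs y Q != 0, (eval_coefs y Q).[t] = 0 & (eval_coefs y Q)^`().[t] != 0].
Proof.
move=> P0; pose D := Pdiv.Idomain.gcdp P P^`().
have /Pdiv.Idomain.dvdpP[[c1 Q] /= c10 eQ] := Pdiv.Idomain.dvdp_gcdl P P^`().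
have /Pdiv.Idomain.dvdpP[[c2 W] /= c20 eW] := Pdiv.Idomain.dvdp_gcdr P P^`().
have [[u v] /= /Pdiv.Idomain.eqpP[[b1 b2] /= /andP[b10 b20] eD]] := Pdiv.Idomain.Bezoutp P P^`().
exists (c1 * c2 * b2 * lead_coef P), Q; split.
  by rewrite !mulf_neq0 // lead_coef_eq0.
move=> y t; rewrite !mevalM !mulf_eq0 !negb_or => /andP[/andP[/andP[h1 h2] h3] h4] rt.
have ep0 : eval_coefs y P != 0.
  by rewrite -lead_coef_eq0 lead_coef_map_eq.
have ed S : eval_coefs y S^`() = (eval_coefs y S)^`() by rewrite /eval_coefs deriv_map.
have /andP[/eqP r1 r2] : root (eval_coefs y Q) t && ((eval_coefs y Q)^`().[t] != 0).
  apply: (@squarefree_part_simple_root _ (eval_coefs y P) _ (eval_coefs y D)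
    (eval_coefs y W) (eval_coefs y u) (eval_coefs y v)
    (meval y c1) (meval y c2) (meval y b1) (meval y b2)) => //.
  - have /(congr1 (eval_coefs y)) := eQ.
    by rewrite /eval_coefs rmorphM /= linearZ_LR.
  - have /(congr1 (eval_coefs y)) := eW.
    by rewrite -ed /eval_coefs rmorphM /= linearZ_LR.
  - have /(congr1 (eval_coefs y)) := eD.
    by rewrite -ed /eval_coefs !linearZ_LR /= rmorphD !rmorphM.
  - exact/eqP.
split=> //; apply: contra_neq r2 => ->; by rewrite deriv0 horner0.
Qed.

(** * Null sets and zeros of polynomials *)

Section NullSets.
Variables (R : realType) (I : finType) (i0 : I).
Implicit Types (S : set (I -> R)).

Definition volume (a b : I -> R) : R := \prod_(i : I) (b i - a i).

Lemma volume_ge0 (a b : I -> R) : (forall i, a i <= b i) -> 0 <= volume a b.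
Proof. by move=> ab; apply: prodr_ge0 => i _; rewrite subr_ge0. Qed.

Lemma sumr_le_subset (T : eqType) (f : T -> R) (l l' : seq T) :
  (forall t, 0 <= f t) -> uniq l -> {subset l <= l'} ->
  \sum_(t <- l) f t <= \sum_(t <- l') f t.
Proof.
move=> f0; elim: l l' => [|x l IH] l' /=.
  by move=> _ _; rewrite big_nil sumr_ge0.
case/andP=> xl ul sub; rewrite big_cons.
have xl' : x \in l' by apply: sub; rewrite mem_head.
rewrite (perm_big _ (perm_to_rem xl')) big_cons lerD2l IH // => y yl.
have : y \in l' by apply: sub; rewrite inE yl orbT.
rewrite (perm_mem (perm_to_rem xl')) inE => /orP[/eqP e|//].
by rewrite -e yl in xl.
Qed.

Definition small_cover S (e : R) := exists a b : nat -> I -> R,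
  (forall m i, a m i <= b m i) /\
  (forall x, S x -> exists m, in_box (a m) (b m) x) /\
  (forall M : nat, \sum_(m < M) volume (a m) (b m) < e).

(** Boxes indexed by [T] are laid out along their codes in [nat]. Unoccupied positions receive the
    box reduced to the origin, whose volume is [0] because [i0] makes the product nonempty. The gap
    between [s] and [e] makes the bound on partial sums strict. *)
Lemma countable_small_cover (T : countType) (a b : T -> I -> R) S s e :
  (forall t i, a t i <= b t i) -> (forall x, S x -> exists t, in_box (a t) (b t) x) ->
  (forall l, uniq l -> \sum_(t <- l) volume (a t) (b t) <= s) -> s < e ->
  small_cover S e.
Proof.
move=> ab cov vol se.
pose pick (c : T -> I -> R) m := oapp c (fun _ => 0) (pickle_inv m).
exists (pick a), (pick b); split; [|split].
- by move=> m i; rewrite /pick; case: pickle_inv => [t|] //=; exact: ab.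
- move=> x /cov[t xt]; exists (pickle t); rewrite /pick.
  have -> // : pickle_inv (pickle t) = Some t.
  exact: pickleK_inv.
- move=> M; apply: le_lt_trans se.
  suff -> : \sum_(m < M) volume (pick a m) (pick b m) =
     \sum_(t <- pmap pickle_inv (iota 0 M)) volume (a t) (b t).
    by apply: vol; apply: (pmap_uniq (@pickle_invK T)); exact: iota_uniq.
  rewrite big_pmap -[M in iota 0 M]subn0 -/(index_iota 0 M) big_mkord.
  apply: eq_bigr => m _; rewrite /pick; case: pickle_inv => [t|] //=.
  by rewrite /volume (bigD1 i0) //= subrr mul0r.
Qed.

Lemma null_sub S S' : S `<=` S' -> lebesgue_null S' -> lebesgue_null S.
Proof.
move=> sub nS' e e0; have [a [b [h1 [h2 h3]]]] := nS' e e0.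
by exists a, b; split=> //; split=> // x /sub /h2.
Qed.

Lemma null_finite_covers S :
  (forall e : R, 0 < e -> exists (T : finType) (a b : T -> I -> R),
     (forall t i, a t i <= b t i) /\ (forall x, S x -> exists t, in_box (a t) (b t) x) /\
     \sum_t volume (a t) (b t) < e) -> lebesgue_null S.
Proof.
move=> h e e0; have [T [a [b [ab [cov vol]]]]] := h e e0.
apply: (countable_small_cover ab cov _ vol) => l ul.
apply: sumr_le_subset => // [t|t _]; first exact: volume_ge0.
by rewrite mem_index_enum.
Qed.

Lemma sum_half_powers (e : R) (l : seq nat) : 0 < e -> uniq l ->
  \sum_(m <- l) e / 2 ^+ m.+2 <= e / 2.
Proof.
move=> e0 ul; pose K := (\max_(m <- l) m).+1.
apply: (@le_trans _ _ (\sum_(m <- iota 0 K) e / 2 ^+ m.+2)).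
  apply: sumr_le_subset => // [m|m ml].
    by rewrite divr_ge0 ?ltW // exprn_ge0.
  by rewrite mem_iota add0n ltnS /=; apply: leq_bigmax_seq.
have -> : \sum_(m <- iota 0 K) e / 2 ^+ m.+2 = e / 2 - e / 2 ^+ K.+1.
  elim: K => [|k IH]; first by rewrite big_nil expr1 subrr.
  rewrite -addn1 iotaD big_cat big_seq1 /= IH add0n addn1 !exprS.
  have : (2 : R) ^+ k != 0 by rewrite expf_neq0.
  by move=> h; field.
by rewrite gerBl divr_ge0 ?ltW // exprn_ge0.
Qed.

Lemma null_bigcup (T : countType) (S : T -> set (I -> R)) :
  (forall t, lebesgue_null (S t)) -> lebesgue_null [set x | exists t, S t x].
Proof.
move=> nS e e0.
(* The weights [e / 2^(n + 2)] add up to at most [e / 2], which leaves room for the strict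
   inequality. *)
have et0 (t : T) : 0 < e / 2 ^+ (pickle t).+2 by rewrite divr_gt0 // exprn_gt0.
have /choice[ab hab] : forall t, exists ab : (nat -> I -> R) * (nat -> I -> R),
  (forall m i, ab.1 m i <= ab.2 m i) /\
  (forall x, S t x -> exists m, in_box (ab.1 m) (ab.2 m) x) /\
  (forall M : nat, \sum_(m < M) volume (ab.1 m) (ab.2 m) < e / 2 ^+ (pickle t).+2).
  by move=> t; have [a [b h]] := nS t _ (et0 t); exists (a, b).
pose a (u : T * nat) := (ab u.1).1 u.2; pose b (u : T * nat) := (ab u.1).2 u.2.
have abu u i : a u i <= b u i by have [h _] := hab u.1; exact: h.
apply: (@countable_small_cover _ a b _ (e / 2)) => //; last by lra.
- move=> x [t Sx]; have [_ [h _]] := hab t; have [m hm] := h x Sx.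
  by exists (t, m).
- move=> l ul; pose l1 := undup (map fst l).
  pose J := (\max_(u <- l) u.2).+1.
  apply: (@le_trans _ _ (\sum_(u <- allpairs pair l1 (iota 0 J)) volume (a u) (b u))).
    apply: sumr_le_subset => // [u|u ul1]; first exact: volume_ge0.
    apply/allpairsP; exists u; split; last by case: u {ul1}.
      by rewrite mem_undup; apply/mapP; exists u.
    by rewrite mem_iota add0n ltnS /=; apply: (leq_bigmax_seq u).
  rewrite big_allpairs_dep /=.
  apply: (@le_trans _ _ (\sum_(t <- l1) e / 2 ^+ (pickle t).+2)).
    apply: ler_sum => t _; have [_ [_ h]] := hab t.
    have := h J; rewrite -(big_mkord predT (fun m => volume (a (t, m)) (b (t, m)))) /=.
    by rewrite /index_iota subn0 => /ltW.
  rewrite -(big_map (@pickle T) predT (fun m => e / 2 ^+ m.+2)).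
  apply: sum_half_powers => //.
  by rewrite map_inj_uniq ?undup_uniq //; exact: pcan_inj pickleK.
Qed.

Lemma null0 : lebesgue_null (set0 : set (I -> R)).
Proof.
apply: null_finite_covers => e e0; exists 'I_0, (fun _ _ => 0), (fun _ _ => 0).
by split=> //; split=> [x []|]; rewrite big_ord0.
Qed.

Lemma nullU S S' : lebesgue_null S -> lebesgue_null S' -> lebesgue_null (S `|` S').
Proof.
move=> nS nS'; have := @null_bigcup bool (fun b => if b then S else S').
move=> /(_ _)/null_sub; apply; last by case.
by move=> x [Sx|Sx]; [exists true|exists false].
Qed.

End NullSets.

Lemma unit_interval_cell (R : realType) (K : nat) (u : R) : (0 < K)%N -> 0 <= u <= 1 ->
  exists k : 'I_K, k%:R / K%:R <= u <= k.+1%:R / K%:R.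
Proof.
case: K => // K _ /andP[u0 u1].
have K0 : (0 : R) < K.+1%:R by rewrite ltr0n.
have [->|un1] := eqVneq u 1.
  by exists ord_max; rewrite ler_pdivrMr // mul1r ler_nat leqnSn divff ?lexx // lt0r_neq0.
have h := truncn_itv (mulr_ge0 u0 (ltW K0)); case/andP: h => h1 h2.
have kK : (Num.truncn (u * K.+1%:R) < K.+1)%N.
  rewrite -(ltr_nat R); apply: le_lt_trans h1 _.
  by rewrite gtr_pMl // lt_neqAle un1.
exists (Ordinal kK); rewrite ler_pdivrMr // ler_pdivlMr //= h1 /=; exact: ltW.
Qed.

Section LipschitzGraph.
Variables (R : realType) (I : finType) (i : I).

(** Cut the unit cube of the remaining coordinates into cells of side [h = 1 / K]. Over one cell the
    coordinate [i] varies by at most [C h] around a chosen point of [S], so the boxes have total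
    volume [K^#|J| * 2 C h * h^#|J| = 2 C / K]. *)
Lemma null_lipschitz_graph (S : set (I -> R)) (lo : I -> R) (L : R) : 0 <= L ->
  (forall y, S y -> forall j, lo j <= y j <= lo j + 1) ->
  (forall y y', S y -> S y' -> `|y i - y' i| <= L * \sum_(j | j != i) `|y j - y' j|) ->
  lebesgue_null S.
Proof.
move=> L0 Slo SL; apply: (null_finite_covers i) => e e0.
pose J : finType := {j : I | j != i}; pose C : R := L * #|J|%:R.
have C0 : 0 <= C by rewrite mulr_ge0.
pose K := (Num.truncn (2 * C / e)).+1.
have K0 : (0 : R) < K%:R by rewrite ltr0n.
have KC : 2 * C / K%:R < e.
  by rewrite ltr_pdivrMr // [e * _]mulrC -ltr_pdivrMr // /K; rewrite truncnS_gt.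
pose h : R := K%:R^-1; have h0 : 0 < h by rewrite invr_gt0.
pose T := {ffun J -> 'I_K}.
pose cell (t : T) (y : I -> R) :=
  forall j : J, lo (val j) + (t j)%:R * h <= y (val j) <= lo (val j) + (t j).+1%:R * h.
(* Over a cell that misses [S] the centre takes an arbitrary value; the box there covers nothing,
   and its volume is the same as for the other cells. *)
pose ctr (t : T) := xget (fun _ => 0) [set y | S y /\ cell t y] i.
pose a (t : T) (j : I) : R :=
  if insub j is Some j' then lo j + (t j')%:R * h else ctr t - C * h.
pose b (t : T) (j : I) : R :=
  if insub j is Some j' then lo j + (t j').+1%:R * h else ctr t + C * h.
exists T, a, b; split; [|split].
- move=> t j; rewrite /a /b; case: insubP => [j' _ _|_].
    by rewrite lerD2l ler_pM2r // ler_nat.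
  by rewrite lerD2l ge0_cp // mulr_ge0 // ltW.
- move=> y Sy.
  have /choice[f hf] : forall j : J, exists k : 'I_K,
      k%:R / K%:R <= y (val j) - lo (val j) <= k.+1%:R / K%:R.
    move=> j; apply: unit_interval_cell => //.
    by rewrite subr_ge0 lerBlDl; exact: Slo.
  pose t : T := [ffun j => f j].
  have cy : cell t y.
    move=> j; have /andP[h1 h2] := hf j; rewrite ffunE.
    by rewrite -lerBrDl h1 -lerBlDl h2.
  exists t => j; rewrite /a /b; case: insubP => [j' _ <-|]; first exact: cy.
  rewrite negbK => /eqP ->.
  have [Sz cz] : [set z | S z /\ cell t z] (xget (fun _ => 0) [set z | S z /\ cell t z]).
    by apply: (xgetPex (fun _ => 0)); exists y.
  have := SL _ _ Sy Sz; rewrite -/(ctr t) ler_distl => H.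
  suff D : L * \sum_(j | j != i) `|y j - xget (fun _ => 0) [set z | S z /\ cell t z] j| <= C * h.
    case/andP: H => H1 H2; apply/andP; split; lra.
  rewrite /C -mulrA ler_wpM2l // card_sig -sum1_card natr_sum mulr_suml.
  apply: ler_sum => k ki; rewrite mul1r.
  have := cy (Sub k ki); have := cz (Sub k ki); rewrite SubK ffunE.
  move=> /andP[x1 x2] /andP[x3 x4]; rewrite ler_norml.
  move: x1 x2 x3 x4; rewrite -addn1 natrD mulrDl mul1r => x1 x2 x3 x4.
  by apply/andP; split; lra.
- have vol t : volume (a t) (b t) = 2 * C * h * h ^+ #|J|.
    rewrite /volume (bigD1 i) //=; congr (_ * _).
      by rewrite /a /b insubF ?eqxx //; ring.
    rewrite card_sig -prodr_const; apply: eq_bigr => j ji.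
    by rewrite /a /b insubT -addn1 natrD; ring.
  rewrite (eq_bigr _ (fun t _ => vol t)) sumr_const card_ffun card_ord -[X in X < _]mulr_natr natrX.
  by rewrite -mulrA -exprMn mulVf ?expr1n ?mulr1 // lt0r_neq0.
Qed.

End LipschitzGraph.

Section PolynomialZeros.
Variable R : realType.

Lemma ratfun_meval (p q N : nat) (D : set 'M[R]_(p, q)) (F : 'I_N -> 'M[R]_(p, q) -> R) P :
  (forall i, ratfun D (F i)) -> ratfun D (fun X => meval (fun i => F i X) P).
Proof.
move=> hF.
have -> : (fun X => meval (fun i => F i X) P) =
    (fun X => \sum_(m <- msupp P) mcoeff m P * \prod_i F i X ^+ m i).
  by apply/funext => X; rewrite mevalE.
apply: ratfun_sum => m _; apply: ratfunM; first exact: ratfun_cst.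
by apply: ratfun_prod => i _; apply: ratfunX.
Qed.

(** A polynomial form of the mean value formula: the polynomials that admit such [G] contain
    constants and variables and are closed under sums and products. The two points are stored as the
    rows of one matrix, so that each [G i] is a rational function of a single argument. *)
Lemma divided_differences (N : nat) (p : mpoly N R) :
  exists G : 'I_N -> 'M[R]_(2, N) -> R, (forall i, ratfun setT (G i)) /\
    (forall X : 'M[R]_(2, N), meval (X 0) p - meval (X 1) p = \sum_i (X 0 i - X 1 i) * G i X) /\
    (forall i (X : 'M[R]_(2, N)), X 0 = X 1 -> G i X = meval (X 0) (mderiv i p)).
Proof.
pose H (p : mpoly N R) := exists G : 'I_N -> 'M[R]_(2, N) -> R, (forall i, ratfun setT (G i)) /\
    (forall X : 'M[R]_(2, N), meval (X 0) p - meval (X 1) p = \sum_i (X 0 i - X 1 i) * G i X) /\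
    (forall i (X : 'M[R]_(2, N)), X 0 = X 1 -> G i X = meval (X 0) (mderiv i p)).
have HC c : H (mpolyC N c).
  exists (fun _ _ => 0); split; [|split].
  - by move=> i; exact: ratfun_cst.
  - by move=> X; rewrite !mevalC subrr big1 // => i _; rewrite mulr0.
  - by move=> i X _; rewrite mderivC meval0.
have HX i : H (mpolyX R (mnm1 i)).
  exists (fun j _ => (i == j)%:R); split; [|split].
  - by move=> j; exact: ratfun_cst.
  - move=> X; rewrite !mevalXU (bigD1 i) //= eqxx mulr1 big1 ?addr0 // => j ji.
    by rewrite eq_sym (negbTE ji) mulr0.
  - move=> j X _; rewrite mderivX mnm1E mevalZ mevalX.
    case: eqVneq => [->|_]; last by rewrite mul0r.
    by rewrite mul1r big1 // => k _; rewrite mnmBE subnn expr0.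
have HD p1 p2 : H p1 -> H p2 -> H (p1 + p2).
  move=> [G [h1 [h2 h3]]] [G' [h1' [h2' h3']]].
  exists (fun i X => G i X + G' i X); split; [|split].
  - by move=> i; apply: ratfunD.
  - move=> X; rewrite !mevalD opprD addrACA h2 h2' -big_split; apply: eq_bigr => i _.
    by rewrite mulrDr.
  - by move=> i X e; rewrite mderivD mevalD h3 // h3'.
have HM p1 p2 : H p1 -> H p2 -> H (p1 * p2).
  move=> [G [h1 [h2 h3]]] [G' [h1' [h2' h3']]].
  exists (fun i X => G i X * meval (X 0) p2 + meval (X 1) p1 * G' i X); split; [|split].
  - move=> i; apply: ratfunD; apply: ratfunM => //;
      by apply: ratfun_meval => j; exact: ratfun_coord.
  - move=> X; rewrite !mevalM.
    have -> : \sum_i (X 0 i - X 1 i) * (G i X * meval (X 0) p2 + meval (X 1) p1 * G' i X) =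
      (\sum_i (X 0 i - X 1 i) * G i X) * meval (X 0) p2 +
      meval (X 1) p1 * \sum_i (X 0 i - X 1 i) * G' i X.
      by rewrite mulr_suml mulr_sumr -big_split; apply: eq_bigr => i _ /=; ring.
    by rewrite -h2 -h2'; ring.
  - by move=> i X e; rewrite mderivM mevalD !mevalM h3 // h3' // e.
change (H p); elim/mpolyind: p => [|c m p _ _ Hp]; first by rewrite -(mpolyC0 N R); exact: HC.
apply: HD => //; rewrite -mul_mpolyC; apply: (HM) => //.
rewrite mpolyXE_id; apply: (big_ind H) => [|x y|i _]; [exact: HC | exact: HM |].
elim: (m i) => [|k IH]; first by rewrite expr0; exact: HC.
by rewrite exprS; apply: HM.
Qed.

End PolynomialZeros.

Lemma mderiv_neq0 (R : realType) (N : nat) (p : mpoly N R) : (1 < mmeasure mdeg p)%N ->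
  exists i, mderiv i p != 0.
Proof.
move=> hp; have p0 : p != 0 by apply: contraTneq hp => ->; rewrite msize0.
have ml := mlead_supp p0; have dl := mlead_deg p0.
have /existsP[i mi] : [exists i, mlead p i != 0%N].
  apply: contraTT hp; rewrite negb_exists => /forallP h; rewrite -dl.
  rewrite mdegE big1 // => i _; exact/eqP/negbNE.
exists i; apply/eqP => /(congr1 (mcoeff (mnm_sub (mlead p) (mnm1 i)))).
rewrite mcoeff0 mcoeff_deriv submK; last by rewrite lep1mP.
by move/eqP; rewrite mulrn_eq0 /= -[_ == 0]negbK -mcoeff_msupp ml.
Qed.

Lemma msize_mderiv (R : realType) (N : nat) (p : mpoly N R) i n :
  (mmeasure mdeg p <= n.+1)%N -> (mmeasure mdeg (mderiv i p) <= n)%N.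
Proof.
move=> hp; rewrite msizeE; apply/bigmax_leqP_seq => m hm _.
have : mnm_add m (mnm1 i) \in msupp p.
  move: hm; rewrite !mcoeff_msupp mcoeff_deriv.
  by apply: contraNneq => ->; rewrite mul0rn.
move/msize_mdeg_lt; rewrite mdegD mdeg1 => h.
by have := leq_trans h hp; rewrite addn1 ltnS.
Qed.

Section PolynomialZeroSet.
Variables (R : realType) (I : finType) (i0 : I).
Let N := #|I|.

Definition coords (y : I -> R) : 'I_N -> R := fun k => y (enum_val k).

(* Two zeros [y], [y'] satisfy [\sum_j (y j - y' j) * G_j = 0] with [G_k] bounded away from [0]. *)
Lemma locally_lipschitz_zeros (p : mpoly N R) k y0 :
  meval (coords y0) (mderiv k p) != 0 ->
  exists (d L : R), 0 < d /\ 0 <= L /\ forall y y' : I -> R,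
    (forall j, `|y j - y0 j| < d) -> (forall j, `|y' j - y0 j| < d) ->
    meval (coords y) p = 0 -> meval (coords y') p = 0 ->
    `|y (enum_val k) - y' (enum_val k)| <=
      L * \sum_(j | j != enum_val k) `|y j - y' j|.
Proof.
move=> dp0; have [G [hG [eG dG]]] := divided_differences p.
pose pair (y y' : I -> R) : 'M[R]_(2, N) := \matrix_(a, j) coords (if a == 0 then y else y') j.
have pair0 y y' : pair y y' 0 = coords y by apply/funext => j; rewrite mxE.
have pair1 y y' : pair y y' 1 = coords y' by apply/funext => j; rewrite mxE.
pose c : R := `|meval (coords y0) (mderiv k p)|.
have c0 : 0 < c by rewrite normr_gt0.
have /choice[dd hdd] : forall j, exists d : R, 0 < d /\
    forall Y : 'M[R]_(2, N), (forall a b, `|Y a b - pair y0 y0 a b| < d) ->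
    `|G j Y - G j (pair y0 y0)| < c / 2.
  move=> j; have [|d d0 h] := @ratfun_modulus _ _ _ _ _ (pair y0 y0) (c / 2) (hG j) Logic.I.
    by rewrite divr_gt0.
  by exists d.
pose d := \big[Num.min/1]_j dd j.
have d0 : 0 < d by apply/bigmin_gtP; split=> // j _; case: (hdd j).
have ddj j : d <= dd j by apply: (@bigmin_le_cond _ _ _ _ j predT).
pose M := \sum_j (`|G j (pair y0 y0)| + c / 2).
have M0 : 0 <= M by apply: sumr_ge0 => j _; rewrite addr_ge0 // ltW // divr_gt0.
exists d, (M / (c / 2)); split=> //; split; first by rewrite divr_ge0 // ltW // divr_gt0.
move=> y y' hy hy' py py'.
set X := pair y y'.
have hX a b : `|X a b - pair y0 y0 a b| < d.
  by rewrite !mxE /coords; case: (a == 0); [exact: hy | exact: hy'].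
have GX j : `|G j X - G j (pair y0 y0)| < c / 2.
  by case: (hdd j) => _; apply => a b; apply: lt_le_trans (ddj j).
have Gk : c / 2 <= `|G k X|.
  have := GX k; rewrite (dG k (pair y0 y0)) ?pair0 ?pair1 // => h.
  have := lerB_dist (meval (coords y0) (mderiv k p)) (G k X).
  rewrite distrC -/c => h2; lra.
have GM j : `|G j X| <= M.
  apply: (@le_trans _ _ (`|G j (pair y0 y0)| + c / 2)).
    have := ler_normD (G j X - G j (pair y0 y0)) (G j (pair y0 y0)).
    by rewrite subrK; have := GX j => h1 h2; lra.
  rewrite /M (bigD1 j) //= lerDl; apply: sumr_ge0 => l _.
  by rewrite addr_ge0 // ltW // divr_gt0.
have := eG X; rewrite pair0 pair1 py py' subr0 (bigD1 k) //= => /eqP.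
rewrite eq_sym addr_eq0 => /eqP E.
have c2 : 0 < c / 2 by rewrite divr_gt0.
rewrite mulrAC ler_pdivlMr // mulrC.
apply: (@le_trans _ _ `|(coords y k - coords y' k) * G k X|).
  by rewrite normrM mulrC ler_wpM2l.
rewrite E normrN; apply: le_trans (ler_norm_sum _ _ _) _.
rewrite mulr_sumr (reindex_onto (@enum_val I predT) enum_rank) /=; last first.
  by move=> *; exact: enum_rankK.
rewrite [leRHS](eq_bigl (fun j => j != k)); last first.
  by move=> j; rewrite enum_valK eqxx andbT (inj_eq enum_val_inj).
by apply: ler_sum => j _; rewrite normrM mulrC ler_wpM2r.
Qed.

(** The local Lipschitz estimate is made countable: [t] records a grid cube, its mesh and an integer
    Lipschitz constant, and [S t] is the zero set in that cube if this constant works there. Every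
    regular zero lies in some [S t] with a fine enough mesh. *)
Lemma null_regular_zeros (p : mpoly N R) k :
  lebesgue_null [set y : I -> R | meval (coords y) p = 0 /\ meval (coords y) (mderiv k p) != 0].
Proof.
pose ii := enum_val k.
pose T := ({ffun I -> int} * nat * nat)%type.
pose lo (t : T) (j : I) : R := (t.1.1 j)%:~R / t.1.2.+1%:R.
pose B (t : T) := [set y : I -> R | meval (coords y) p = 0 /\
   forall j, lo t j <= y j <= lo t j + t.1.2.+1%:R^-1].
pose S (t : T) := [set y | B t y /\ forall z z', B t z -> B t z' ->
   `|z ii - z' ii| <= t.2%:R * \sum_(j | j != ii) `|z j - z' j|].
have nS t : lebesgue_null (S t).
  apply: (@null_lipschitz_graph _ _ ii _ (lo t) t.2%:R) => //.
    move=> y [[_ h] _] j; have /andP[-> h2] /= := h j.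
    apply: le_trans h2 _; rewrite lerD2l invf_le1 ?ler1n ?ltr0n //.
  by move=> y y' [By h] [By' _]; exact: h.
apply: null_sub (null_bigcup i0 nS) => y0 [py0 dp0].
have [d [L [d0 [L0 h]]]] := locally_lipschitz_zeros dp0.
pose m := Num.truncn d^-1.
have m0 : (0 : R) < m.+1%:R by rewrite ltr0n.
have md : m.+1%:R^-1 < d.
  rewrite -[ltRHS]invrK ltf_pV2 ?posrE ?invr_gt0 //; rewrite truncnS_gt //.
pose t : T := ([ffun j => Num.floor (y0 j * m.+1%:R)], m, (Num.truncn L).+1).
have By0 j : lo t j <= y0 j <= lo t j + m.+1%:R^-1.
  rewrite /lo /= ffunE; have /andP[h1 h2] := floor_itv (y0 j * m.+1%:R).
  rewrite ler_pdivrMr // h1 /= -[X in _ + X]mul1r -mulrDl ler_pdivlMr //.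
  by apply: ltW; rewrite -intrD1.
have close y : B t y -> forall j, `|y j - y0 j| < d.
  move=> [_ hy] j; apply: le_lt_trans md; have := hy j; have := By0 j; rewrite [t.1.2]/=.
  move=> /andP[a1 a2] /andP[a3 a4]; rewrite ler_norml; apply/andP.
  by move: (lo t j) (m.+1%:R^-1 : R) a1 a2 a3 a4 => u v *; split; lra.
exists t; split=> // z z' Bz Bz'.
apply: le_trans (h z z' (close _ Bz) (close _ Bz') Bz.1 Bz'.1) _.
apply: ler_wpM2r; first by apply: sumr_ge0.
by apply: ltW; rewrite truncnS_gt.
Qed.

(** Induction on the degree: a nonconstant [p] has a nonzero partial derivative of smaller degree.
    Its zeros are null by induction, and off them the zeros of [p] are regular. *)
Lemma null_mpoly_zeros (p : mpoly N R) : p != 0 ->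
  lebesgue_null [set y : I -> R | meval (coords y) p = 0].
Proof.
have [n] := ubnP (mmeasure mdeg p); elim: n p => // n IH p hp p0.
have [h1|h1] := leqP (mmeasure mdeg p) 1.
  have n0 := @null0 R _ i0; apply: null_sub n0 => y /= py; case/eqP: p0.
  by move: py; rewrite (msize1_polyC h1) mevalC => ->; rewrite mpolyC0.
have [k dk] := mderiv_neq0 h1.
apply: null_sub (nullU i0 (IH _ _ dk) (null_regular_zeros p k)).
  move=> y /= py; have [e|e] := eqVneq (meval (coords y) (mderiv k p)) 0; first by left.
  by right.
case E: (mmeasure mdeg p) h1 hp => [//|l] _ hp.
by apply: (@leq_ltn_trans l) => //; apply: msize_mderiv; rewrite E.
Qed.

End PolynomialZeroSet.

(** * Critical points of generic distance functions *)

Lemma poly_roots_in_seq (R : fieldType) (p : {poly R}) : p != 0 ->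
  exists s : seq R, forall t, p.[t] = 0 -> t \in s.
Proof.
have [n] := ubnP (size p); elim: n p => // n IH p hp p0.
have [[t0 rt0]|h] := pselect (exists t0, root p t0); last first.
  by exists [::] => t pt; exfalso; apply: h; exists t; apply/eqP.
have /factor_theorem[q eq] := rt0.
have q0 : q != 0 by apply: contraNneq p0 => q0; rewrite eq q0 mul0r.
have [|//|s hs] := IH q.
  move: hp; rewrite eq size_Mmonic ?monicXsubC // size_XsubC addn2 /=.
  by case: (size q).
exists (t0 :: s) => t; rewrite eq hornerM hornerXsubC => /eqP.
rewrite mulf_eq0 inE subr_eq0 => /orP[/eqP /hs ->|->//]; exact: orbT.
Qed.

Lemma finite_rows (R : realType) (d : nat) (s : 'I_d -> seq R) :
  finite_set [set z : 'rV[R]_d | forall i, z 0 i \in s i].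
Proof.
pose M := (\max_i size (s i)).+1.
pose h (phi : {ffun 'I_d -> 'I_M}) : 'rV[R]_d := \row_i nth 0 (s i) (phi i).
apply: sub_finite_set (finite_image h (@finite_finset _ setT)) => z hz.
have lt i : (index (z ord0 i) (s i) < M)%N.
  by rewrite ltnS ltnW // (leq_trans _ (leq_bigmax i)) // index_mem.
exists [ffun i => Ordinal (lt i)] => //; apply/rowP => i; rewrite !mxE ffunE /=.
by rewrite nth_index.
Qed.

(** The coefficients are stationary along [u], so only the dependence through [g] contributes. At a
    simple root, a vanishing total derivative therefore forces [dg = 0]. *)
Lemma is_derive_eval_coefs (R : realType) (V : normedModType R) (N : nat)
    (Q : {poly (mpoly N R)}) (A : 'I_N -> V -> R) (g : V -> R) (w u : V) (dg : R) :
  (forall k, is_derive w u (A k) 0) -> is_derive w u g dg ->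
  is_derive w u (fun x => (eval_coefs (fun k => A k x) Q).[g x])
    ((eval_coefs (fun k => A k w) Q)^`().[g w] * dg).
Proof.
move=> hA hg; have hm (c : mpoly N R) : is_derive w u (fun x => meval (fun k => A k x) c) 0.
  pose h (x : V) : 'rV[R]_N := \row_k A k x.
  have e : (fun x => meval (fun k => A k x) c) = (fun x => meval (h x 0) c).
    by apply/funext => x; congr meval; apply/funext => k; rewrite mxE.
  rewrite e; apply: (@ratfun_chain0 _ _ _ _ setT (fun X : 'rV[R]_N => meval (X 0) c)) => //.
    by apply: ratfun_meval => k; exact: ratfun_coord.
  move=> i j; rewrite (_ : (fun y => h y i j) = A j) //.
  by apply/funext => x; rewrite mxE.
elim/poly_ind: Q => [|Q c IH].
  have -> : (fun x => (eval_coefs (fun k => A k x) 0).[g x]) = (fun _ => 0).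
    by apply/funext => x; rewrite /eval_coefs raddf0 horner0.
  by rewrite /eval_coefs raddf0 deriv0 horner0 mul0r; exact: is_derive_cst.
have ev y : eval_coefs y (Q * 'X + c%:P) = eval_coefs y Q * 'X + (meval y c)%:P.
  by rewrite /eval_coefs rmorphD rmorphM /= map_polyX map_polyC.
have -> : (fun x => (eval_coefs (fun k => A k x) (Q * 'X + c%:P)).[g x]) =
   (fun x => (eval_coefs (fun k => A k x) Q).[g x] * g x + meval (fun k => A k x) c).
  by apply/funext => x; rewrite ev !hornerE.
rewrite ev derivD derivM derivX derivC addr0 mulr1 hornerD hornerM hornerX.
apply: (is_derive_eq (is_deriveD (is_deriveM IH hg) (hm c))).
by rewrite /GRing.scale /=; ring.
Qed.

(** [h] carries the line through [w] in direction [u] to the line through [h w] in direction [v]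
    with the same parameter, so both derivatives are limits of one and the same difference
    quotient. *)
Lemma derive_comp_line (R : realType) (V V' W : normedModType R) (f : V -> W) (h : V' -> V) w u v :
  (forall s : R, h (s *: u + w) = s *: v + h w) -> 'D_u (f \o h) w = 'D_v f (h w).
Proof.
move=> hh; rewrite /derive.
set g1 := (fun s => s^-1 *: _); set g2 := (fun s => s^-1 *: _).
suff -> : g1 = g2 by [].
by apply/funext => s; rewrite /g1 /g2 /= hh.
Qed.

Lemma derive_translate (R : realType) (V W : normedModType R) (f : V -> W) z y v :
  'D_v (fun y => f (z + y)) y = 'D_v f (z + y).
Proof. by apply: (@derive_comp_line _ _ _ _ f (fun y => z + y)) => s; rewrite addrCA. Qed.

Lemma ratfun_near_neq0 (R : realType) (p q : nat) (D : set 'M[R]_(p, q)) f X :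
  ratfun D f -> D X -> f X != 0 -> \near X, f X != 0.
Proof. by move=> hf DX fX; exact: (cvgr_neq0 (f X) (ratfun_continuous hf DX) fX). Qed.

(** * Solving the critical equations for part of the data *)

Section Elimination.
Variables (R : realType) (d N : nat) (F : 'I_N -> 'rV[R]_d -> R).
Hypothesis hF : forall k, ratfun setT (F k).

Let dF k (b : 'I_d) : 'rV[R]_d -> R := 'D_(evec R b) (F k).

Let ratfun_dF k b : ratfun setT (dF k b).
Proof. exact: ratfun_deriveT. Qed.

Definition critical_eq (A : 'I_N -> R) (z : 'rV[R]_d) (b : 'I_d) : R :=
  \sum_k dF k b z * (A k - F k z).

(* Near a point where the rows [f] of the Jacobian are independent, the critical equations
   determine [A] at the indices [f a], and the vector [w] consists of the parameters [z] (stored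
   at the indices [f a]) together with the other entries of [A]. *)
Variable f : {ffun 'I_d -> 'I_N}.

Definition param (w : 'rV[R]_N) : 'rV[R]_d := \row_a w 0 (f a).

Definition jac (w : 'rV[R]_N) : 'M[R]_d := \matrix_(a, b) dF (f a) b (param w).

Definition rhs (w : 'rV[R]_N) : 'rV[R]_d :=
  \row_b - \sum_(k | k \notin codom f) dF k b (param w) * (w 0 k - F k (param w)).

(** Cramer's rule for the residual [A - F] at the selected indices, written with the adjugate to
    remain visibly rational. *)
Definition solved (w : 'rV[R]_N) : 'rV[R]_d :=
  (\det (jac w))^-1 *: (rhs w *m \adj (jac w)).

Definition datum (k : 'I_N) (w : 'rV[R]_N) : R :=
  if [pick a | f a == k] is Some a then F k (param w) + solved w 0 a else w 0 k.

(** Injectivity of [f] belongs to the domain, so that exceptional polynomials can be chosen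
    uniformly over all functions [f]; for a non-injective one the domain is empty. *)
Definition elim_dom : set 'rV[R]_N := [set w | injective f /\ \det (jac w) != 0].

Definition elim_point (A : 'I_N -> R) (z : 'rV[R]_d) : 'rV[R]_N :=
  \row_k if [pick a | f a == k] is Some a then z 0 a else A k.

Lemma ratfun_param D g : ratfun setT g -> ratfun D (fun w => g (param w)).
Proof.
move=> hg; apply: (ratfun_comp (D := setT)) => // i j.
rewrite (_ : (fun w : 'rV[R]_N => param w i j) = (fun w : 'rV[R]_N => w 0 (f j))).
  exact: ratfun_coord.
by apply/funext => w; rewrite mxE.
Qed.

Lemma ratfun_jac D i j : ratfun D (fun w => jac w i j).
Proof.
rewrite (_ : (fun w => jac w i j) = (fun w => dF (f i) j (param w))).
  exact: ratfun_param.
by apply/funext => w; rewrite mxE.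
Qed.

Lemma ratfun_datum k : ratfun elim_dom (datum k).
Proof.
rewrite /datum; case: pickP => [a _|_]; last exact: ratfun_coord.
apply: ratfunD; first exact: ratfun_param.
rewrite (_ : (fun w => solved w 0 a) =
   (fun w => (\det (jac w))^-1 * (rhs w *m \adj (jac w)) 0 a)); last first.
  by apply/funext => w; rewrite mxE.
apply: ratfunM.
  apply: ratfunV; first by move=> w [].
  by apply: ratfun_det => i j; exact: ratfun_jac.
apply: ratfun_mulmx => i j.
  rewrite (_ : (fun w => rhs w i j) = (fun w => - \sum_(k | k \notin codom f)
     dF k j (param w) * (w 0 k - F k (param w)))); last first.
    by apply/funext => w; rewrite mxE.
  apply: ratfunN; apply: ratfun_sum => l _; apply: ratfunM; first exact: ratfun_param.
  by apply: ratfunB; [exact: ratfun_coord | exact: ratfun_param].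
by apply: ratfun_adj => a' b'; exact: ratfun_jac.
Qed.

Lemma pick_image a : injective f -> [pick a' | f a' == f a] = Some a.
Proof.
move=> fI; case: pickP => [a' /eqP/fI -> //|/(_ a)]; by rewrite eqxx.
Qed.

Lemma pick_out k : k \notin codom f -> [pick a | f a == k] = None.
Proof.
move=> kf; case: pickP => // a /eqP e; by rewrite -e codom_f in kf.
Qed.

Lemma sum_codom (g : 'I_N -> R) : injective f ->
  \sum_k g k = \sum_a g (f a) + \sum_(k | k \notin codom f) g k.
Proof.
move=> fI; rewrite (bigID (mem (codom f))) /=; congr (_ + _).
rewrite (reindex_omap f (fun k => [pick a | f a == k])) /=; last first.
  by move=> k /codomP[a ->]; rewrite pick_image.
by apply: eq_bigl => a; rewrite codom_f pick_image // eqxx.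
Qed.

Lemma jac_eq_solve w (x : 'rV[R]_d) : \det (jac w) != 0 ->
  x *m jac w = rhs w -> x = solved w.
Proof.
move=> dj e; rewrite /solved -e -mulmxA mul_mx_adj mul_mx_scalar scalerA mulVf //.
by rewrite scale1r.
Qed.

Lemma critical_datum w b : elim_dom w ->
  critical_eq (fun k => datum k w) (param w) b = 0.
Proof.
move=> [fI dj]; rewrite /critical_eq sum_codom //.
have : solved w *m jac w = rhs w.
  by rewrite /solved -scalemxAl -mulmxA mul_adj_mx mul_mx_scalar scalerA mulVf // scale1r.
move/rowP/(_ b); rewrite !mxE => e.
have -> : \sum_a dF (f a) b (param w) * (datum (f a) w - F (f a) (param w)) =
    \sum_j solved w 0 j * jac w j b.
  by apply: eq_bigr => a _; rewrite /datum pick_image // [jac _ _ _]mxE [F _ _ + _]addrC addrK mulrC.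
rewrite e addrC; apply/eqP; rewrite addr_eq0 opprK; apply/eqP.
by apply: eq_bigr => k kf; rewrite /datum pick_out.
Qed.

Lemma param_elim_point A z : injective f -> param (elim_point A z) = z.
Proof. by move=> fI; apply/rowP => a; rewrite !mxE pick_image. Qed.

(** With an invertible minor, the critical equations determine the selected residuals uniquely.
    Hence the true residuals are the solved ones, and every critical pair lies in the image of the
    parametrization. *)
Lemma datum_elim_point A z k : (forall b, critical_eq A z b = 0) ->
  elim_dom (elim_point A z) -> datum k (elim_point A z) = A k.
Proof.
move=> cz [fI dj]; rewrite /datum.
have pz := param_elim_point A z fI.
case: pickP => [a /eqP <-|h]; last first.
  by rewrite mxE; case: pickP => // a; rewrite h.
pose x := \row_a (A (f a) - F (f a) z).
have <- : x = solved (elim_point A z).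
  apply: jac_eq_solve => //; apply/rowP => b; rewrite !mxE.
  have := cz b; rewrite /critical_eq sum_codom // => /eqP; rewrite addr_eq0 => /eqP.
  rewrite pz => e; transitivity (- \sum_(k | k \notin codom f) dF k b z * (A k - F k z)).
    rewrite -e; apply: eq_bigr => a' _; by rewrite !mxE pz mulrC.
  by congr (- _); apply: eq_bigr => k' kf; rewrite mxE pick_out.
by rewrite mxE pz addrC subrK.
Qed.

Lemma near_elim_dom w : elim_dom w -> \near w, elim_dom w.
Proof.
move=> [fI dj].
have := @ratfun_near_neq0 _ _ _ setT (fun w => \det (jac w)) w.
move=> /(_ _ Logic.I dj)/filterS; apply => //.
by apply: ratfun_det => i j; exact: ratfun_jac.
Qed.

(** The lift of [v]: it moves the stored parameters by [v] and keeps the free entries of the datum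
    fixed. *)
Let u_ (v : 'rV[R]_d) : 'rV[R]_N := \row_k if [pick a | f a == k] is Some a then v 0 a else 0.

Lemma derive_param (g : 'rV[R]_d -> R) w v : injective f ->
  'D_(u_ v) (g \o param) w = 'D_v g (param w).
Proof.
move=> fI; apply: derive_comp_line => s; apply/rowP => a.
by rewrite !mxE pick_image.
Qed.

(* A direction in the kernel of the Hessian lifts to a direction along which the data [A] is
   stationary. *)
Lemma derive_datum0 w v k : elim_dom w ->
  (forall b, 'D_v (fun z => critical_eq (fun k => datum k w) z b) (param w) = 0) ->
  is_derive w (u_ v) (datum k) 0.
Proof.
move=> Dw hv; have [fI dj] := Dw.
have dA l : derivable (datum l) w (u_ v) by exact: (ratfun_derivable (ratfun_datum l) Dw).
suff h : forall l, 'D_(u_ v) (datum l) w = 0 by apply: DeriveDef.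
have out l : l \notin codom f -> 'D_(u_ v) (datum l) w = 0.
  move=> lf; rewrite (_ : datum l = (fun w : 'rV[R]_N => w 0 l)); last first.
    by apply/funext => y; rewrite /datum pick_out.
  have := derive_mx (@derivable_id R 'rV[R]_N w (u_ v)).
  rewrite derive_id => /matrixP/(_ 0 l).
  by rewrite !mxE pick_out.
suff inn a : 'D_(u_ v) (datum (f a)) w = 0.
  move=> l; have [/codomP[a ->]|/out //] := boolP (l \in codom f); exact: inn.
pose x := \row_a 'D_(u_ v) (datum (f a)) w.
suff x0 : x *m jac w = 0.
  have : x = 0.
    have ju : jac w \in unitmx by rewrite unitmxE unitfE.
    by rewrite -(mulmxK ju x) x0 mul0mx.
  by move/rowP/(_ a); rewrite !mxE.
apply/rowP => b; rewrite !mxE.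
have dP g : ratfun setT g -> derivable (g \o param) w (u_ v).
  by move=> hg; apply: (@ratfun_derivable _ _ _ setT) => //; exact: ratfun_param.
(* The critical equations hold identically near [w], so their total derivative vanishes ([E1],
   [E2]). The hypothesis [hv] differentiates them with frozen data ([E3]). The difference retains
   only the derivatives of the data, which is the linear system [x *m jac w = 0]. *)
have E1 : 'D_(u_ v) (fun y => critical_eq (fun k => datum k y) (param y) b) w = 0.
  rewrite -(derive_cst (0 : R) w (u_ v)); apply: near_eq_derive.
  by near=> y; apply: critical_datum; near: y; exact: near_elim_dom.
have E2 : 'D_(u_ v) (fun y => critical_eq (fun k => datum k y) (param y) b) w =
   \sum_k ('D_v (dF k b) (param w) * (datum k w - F k (param w)) +
      dF k b (param w) * ('D_(u_ v) (datum k) w - 'D_v (F k) (param w))).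
  rewrite (_ : (fun y => _) = \sum_k ((dF k b \o param) * (datum k - (F k \o param)))); last first.
    by apply/funext => y; rewrite fct_sumE.
  rewrite derive_sum => [|l]; last first.
    by apply: derivableM; [exact: dP|apply: derivableB => //; exact: dP].
  apply: eq_bigr => l _; rewrite deriveM; [|exact: dP|apply: derivableB => //; exact: dP].
  rewrite deriveB //; last exact: dP.
  by rewrite !derive_param // /GRing.scale /= addrC [X in X + _]mulrC.
have E3 : 'D_v (fun z => critical_eq (fun k => datum k w) z b) (param w) =
   \sum_k ('D_v (dF k b) (param w) * (datum k w - F k (param w)) -
      dF k b (param w) * 'D_v (F k) (param w)).
  have dT g : ratfun setT g -> derivable g (param w) v by move=> hg; exact: (ratfun_derivable hg).
  rewrite (_ : (fun y => _) = \sum_k (dF k b * (cst (datum k w) - F k))); last first.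
    by apply/funext => y; rewrite fct_sumE.
  rewrite derive_sum => [|l]; last first.
    apply: derivableM; [exact: dT|apply: derivableB; [exact: derivable_cst|exact: dT]].
  apply: eq_bigr => l _; rewrite deriveM; [|exact: dT|]; last first.
    by apply: derivableB; [exact: derivable_cst|exact: dT].
  rewrite deriveB; [|exact: derivable_cst|exact: dT].
  by rewrite derive_cst sub0r /GRing.scale /= mulrN addrC [X in X - _]mulrC.
have : \sum_k dF k b (param w) * 'D_(u_ v) (datum k) w = 0.
  move: E1 (hv b); rewrite E2 E3 => e2 e3.
  have := congr2 (fun x y => x - y) e2 e3; rewrite subr0 -sumrB => e.
  by rewrite -[RHS]e; apply: eq_bigr => l _; ring.
rewrite sum_codom // [X in _ + X]big1 => [|l lf]; last by rewrite out // mulr0.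
rewrite addr0 => e; rewrite -[RHS]e; apply: eq_bigr => a' _.
by rewrite !mxE mulrC.
Unshelve. all: by end_near. Qed.

End Elimination.

(** * Finiteness and nondegeneracy for generic data *)

Section GenericMorse.
Variables (R : realType) (d N : nat) (F : 'I_N -> 'rV[R]_d -> R).
Hypothesis hF : forall k, ratfun setT (F k).

Definition immersive (z : 'rV[R]_d) := forall c : 'rV[R]_d,
  (forall k, \sum_b c 0 b * 'D_(evec R b) (F k) z = 0) -> c = 0.

Lemma immersive_minor z : immersive z -> exists f : {ffun 'I_d -> 'I_N},
  injective f /\ \det (\matrix_(a, b) 'D_(evec R b) (F (f a)) z) != 0.
Proof.
move=> iz; pose M : 'M[R]_(N, d) := \matrix_(k, b) 'D_(evec R b) (F k) z.
have rM : row_full M.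
  rewrite /row_full -mxrank_tr -/(row_free M^T) -kermx_eq0; apply/rowV0P => c /sub_kermxP cM.
  apply: iz => k; move/rowP/(_ k): cM; rewrite !mxE => e; rewrite -[RHS]e.
  by apply: eq_bigr => b _; rewrite !mxE.
exists (fullrankfun rM); split; first exact: fullrankfun_inj.
have := fullrowsub_unit rM; rewrite unitmxE unitfE.
by congr (\det _ != 0); apply/matrixP => a b; rewrite !mxE.
Qed.

Lemma elim_dom_point (f : {ffun 'I_d -> 'I_N}) A z : injective f ->
  \det (\matrix_(a, b) 'D_(evec R b) (F (f a)) z) != 0 -> elim_dom F f (elim_point f A z).
Proof.
move=> fI dz; split=> //; congr (\det _ != 0): dz.
by apply/matrixP => a b; rewrite !mxE param_elim_point.
Qed.

(** Combines the dependence relation with the passage to simple roots. The pair [r] depends on [f]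
    and [i] only: [r.1] describes the data to be avoided, and [r.2] the polynomial of which the
    [i]-th coordinate is a root. *)
Lemma coordinate_algebraic (f : {ffun 'I_d -> 'I_N}) (i : 'I_d) :
  exists r : mpoly N R * {poly (mpoly N R)}, r.1 != 0 /\
    forall w, elim_dom F f w -> meval (fun k => datum F f k w) r.1 != 0 ->
      let p := eval_coefs (fun k => datum F f k w) r.2 in
      [/\ p != 0, p.[param f w 0 i] = 0 & p^`().[param f w 0 i] != 0].
Proof.
have [||P P0 hP] := @ratfun_dependent R N (elim_dom F f) (fun w => param f w 0 i)
    (datum F f).
- rewrite (_ : (fun w => _) = (fun w : 'rV[R]_N => w 0 (f i))); first exact: ratfun_coord.
  by apply/funext => w; rewrite mxE.
- by move=> k; exact: ratfun_datum.
have [c [Q [c0 hQ]]] := generic_simple_roots P0.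
by exists (c, Q); split=> // w Dw cw; apply: hQ => //; exact: hP.
Qed.

Lemma generic_critical_points : exists c : {ffun 'I_d -> 'I_N} -> 'I_d -> mpoly N R,
  (forall f i, c f i != 0) /\
  forall A : 'I_N -> R, (forall f i, meval A (c f i) != 0) ->
    finite_set [set z | (forall b, critical_eq F A z b = 0) /\ immersive z] /\
    forall z, (forall b, critical_eq F A z b = 0) -> immersive z ->
      forall v, (forall b, 'D_v (fun z' => critical_eq F A z' b) z = 0) -> v = 0.
Proof.
have /choice[r0 hr0] := fun fi => coordinate_algebraic fi.1 fi.2.
pose r f i := r0 (f, i); have hr f i := hr0 (f, i).
exists (fun f i => (r f i).1); split=> [f i|A cA]; first by have [] := hr f i.
have eA f z : (forall b, critical_eq F A z b = 0) -> elim_dom F f (elim_point f A z) ->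
    (fun k => datum F f k (elim_point f A z)) = A.
  by move=> cz Dz; apply/funext => k; exact: datum_elim_point.
have root_coord f z : (forall b, critical_eq F A z b = 0) -> elim_dom F f (elim_point f A z) ->
   forall i, [/\ eval_coefs A (r f i).2 != 0, (eval_coefs A (r f i).2).[z 0 i] = 0 &
      (eval_coefs A (r f i).2)^`().[z 0 i] != 0].
  move=> cz Dz i; have [_ h] := hr f i; have := h _ Dz.
  by rewrite /= eA // (param_elim_point _ _ Dz.1); apply; exact: cA.
split.
  pose P f := [set z | (forall b, critical_eq F A z b = 0) /\ elim_dom F f (elim_point f A z)].
  have fP f : finite_set (P f).
    (* The polynomials in question depend on [A], [f] and [i] but not on the critical point. A
       single critical point [z0] shows that they are nonzero, and then their roots confine all the
       others. *)
    have [[z0 [cz0 Dz0]]|h] := pselect (exists z, P f z); last first.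
      by rewrite (_ : P f = set0) //; apply/seteqP; split=> // z Pz; apply: h; exists z.
    have /choice[s hs] : forall i, exists s : seq R,
        forall t, (eval_coefs A (r f i).2).[t] = 0 -> t \in s.
      by move=> i; have [p0 _ _] := root_coord f z0 cz0 Dz0 i; exact: poly_roots_in_seq.
    apply: sub_finite_set (finite_rows s) => z [cz Dz] i.
    by apply: hs; have [] := root_coord f z cz Dz i.
  apply: (@sub_finite_set _ _ (\bigcup_(f in setT) P f)).
    move=> z [cz iz]; have [f [fI dz]] := immersive_minor iz.
    by exists f => //; split=> //; exact: elim_dom_point.
  by apply: bigcup_finite => // ; exact: finite_finset.
move=> z cz iz v hv; have [f [fI dz]] := immersive_minor iz.
have Dw := elim_dom_point A fI dz; set w := elim_point f A z in Dw.
have ew : (fun k => datum F f k w) = A by exact: eA.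
have pw : param f w = z by exact: param_elim_point.
pose u := \row_k (if [pick a | f a == k] is Some a then v 0 a else 0 : R).
have dA k : is_derive w u (datum F f k) 0.
  apply: derive_datum0 => // b.
  rewrite pw -{1}(hv b); congr ('D_v _ _); apply/funext => y.
  by have <- := ew.
apply/rowP => i; rewrite mxE.
have [c0 hc] := hr f i.
have [_ _ sr] := root_coord f z cz Dw i.
have dg : is_derive w u (fun y : 'rV[R]_N => param f y 0 i) (v 0 i).
  rewrite (_ : (fun y => _) = (fun y : 'rV[R]_N => y 0 (f i))); last first.
    by apply/funext => y; rewrite mxE.
  apply: DeriveDef; first exact: (ratfun_derivable (@ratfun_coord _ _ _ setT 0 (f i))).
  have := derive_mx (@derivable_id R 'rV[R]_N w u).
  rewrite derive_id => /matrixP/(_ 0 (f i)).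
  by rewrite !mxE pick_image.
have := is_derive_eval_coefs (r f i).2 dA dg.
rewrite ew pw => D1.
(* The root relation holds at every [w] nearby and not only for the datum [A], since the domain and
   the nonvanishing of the exceptional polynomial are open conditions. The composite is thus locally
   the constant [0]. *)
have D2 : is_derive w u (fun x => (eval_coefs (fun k => datum F f k x) (r f i).2).[param f x 0 i]) 0.
  apply: near_eq_is_derive (is_derive_cst (0 : R) w u).
  have n1 := near_elim_dom hF Dw.
  have n2 : \near w, meval (fun k => datum F f k w) (r f i).1 != 0.
    apply: (@ratfun_near_neq0 _ _ _ (elim_dom F f)) => //; last by rewrite ew.
    by apply: ratfun_meval => k; exact: ratfun_datum.
  near=> y; apply/esym.
  have Dy : elim_dom F f y by near: y.
  have cy : meval (fun k => datum F f k y) (r f i).1 != 0 by near: y.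
  by have [] := hc y Dy cy.
have := @derive_val _ _ _ _ _ _ _ D1; rewrite (@derive_val _ _ _ _ _ _ _ D2) => /esym/eqP.
by rewrite mulf_eq0 (negbTE sr) => /eqP.
Unshelve. all: by end_near. Qed.

End GenericMorse.

Lemma sum_enum_val (V : nmodType) (I : finType) (g : I -> V) :
  \sum_m g m = \sum_(k < #|I|) g (enum_val k).
Proof. by rewrite -big_enum_val. Qed.

Section HalfSquareDistance.
Variables (R : realType) (I : finType) (d : nat) (F : I -> 'rV[R]_d -> R).
Hypothesis hF : forall m, ratfun setT (F m).

Definition half_sqdist (A : I -> R) (y : 'rV[R]_d) : R := 2^-1 * \sum_m (A m - F m y) ^+ 2.

Lemma derive_half_sqdist A v y :
  'D_v (half_sqdist A) y = - \sum_m 'D_v (F m) y * (A m - F m y).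
Proof.
have dm m : derivable (F m) y v by exact: (ratfun_derivable (hF m)).
have -> : half_sqdist A = 2^-1 \*: \sum_(k < #|I|)
    (cst (A (enum_val k)) - F (enum_val k)) ^+ 2.
  apply/funext => x; rewrite /half_sqdist /= fct_sumE /GRing.scale /=; congr (_ * _).
  by rewrite sum_enum_val.
have dk k : derivable (cst (A (enum_val k)) - F (enum_val k) : 'rV[R]_d -> R) y v.
  by apply: derivableB => //; exact: derivable_cst.
rewrite deriveZ; last by apply: derivable_sum => k; exact: derivableX.
rewrite derive_sum => [|k]; last exact: derivableX.
rewrite [in RHS]sum_enum_val.
rewrite scaler_sumr -sumrN; apply: eq_bigr => k _.
rewrite deriveX // deriveB // derive_cst.
rewrite /GRing.scale /= expr1 sub0r -[_ *+ 2]mulr_natl.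
have -> : (cst (A (enum_val k)) - F (enum_val k)) y = A (enum_val k) - F (enum_val k) y by [].
by field.
Qed.

Lemma ratfun_half_sqdist A : ratfun setT (half_sqdist A).
Proof.
apply: ratfunM; first exact: ratfun_cst.
apply: ratfun_sum => m _; apply: ratfunX; apply: ratfunB => //; exact: ratfun_cst.
Qed.

(** The second clause restricts to points where [F] is an immersion: the charts also contain points
    outside [W], with zero weights or dependent columns, where this may fail. *)
Definition crit_points (A : I -> R) := [set z : 'rV[R]_d |
  (forall b, \sum_m 'D_(evec R b) (F m) z * (A m - F m z) = 0) /\
  forall c : 'rV[R]_d, (forall m, \sum_b c 0 b * 'D_(evec R b) (F m) z = 0) -> c = 0].

Lemma row_evec (v : 'rV[R]_d) : v = \sum_a v 0 a *: evec R a.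
Proof. exact: row_sum_delta. Qed.

Theorem generic_morse (i0 : I) : exists S : set (I -> R), lebesgue_null S /\
  forall A, ~ S A -> finite_set (crit_points A) /\
    forall z, crit_points A z ->
      (forall b, 'D_(evec R b) (half_sqdist A) z = 0) /\
      (\matrix_(a < d, b < d) 'D_(evec R a) ('D_(evec R b) (half_sqdist A)) z) \in unitmx.
Proof.
pose F' (k : 'I_#|I|) := F (enum_val k).
have [c [c0 hc]] := @generic_critical_points R d #|I| F' (fun k => hF (enum_val k)).
exists [set A | exists u : {ffun 'I_d -> 'I_#|I|} * 'I_d, meval (coords A) (c u.1 u.2) = 0].
split.
  apply: (@null_bigcup _ _ i0 _ (fun u : {ffun 'I_d -> 'I_#|I|} * 'I_d =>
    [set A : I -> R | meval (coords A) (c u.1 u.2) = 0])) => u.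
  exact: null_mpoly_zeros.
move=> A nA; have [|fin nondeg] := hc (coords A).
  by move=> f i; apply/eqP => e; apply: nA; exists (f, i).
have crE z b : critical_eq F' (coords A) z b = \sum_m 'D_(evec R b) (F m) z * (A m - F m z).
  by rewrite sum_enum_val.
have cr z : crit_points A z ->
    (forall b, critical_eq F' (coords A) z b = 0) /\ immersive F' z.
  move=> [h1 h2]; split=> [b|e he]; first by rewrite crE.
  by apply: h2 => m; have := he (enum_rank m); rewrite /F' enum_rankK.
split; first by apply: sub_finite_set fin => z /cr.
move=> z cz; split=> [b|].
  by rewrite derive_half_sqdist; case: cz => -> _; rewrite oppr0.
have [cz1 iz] := cr z cz.
set H := \matrix_(a, b) _.
(* A row vector that the Hessian kills is a direction in which all partial derivatives, that is all
   critical equations up to sign, are stationary. *)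
rewrite -row_free_unit -kermx_eq0; apply/rowV0P => v /sub_kermxP vH.
apply: (nondeg z cz1 iz) => b.
have -> : (fun z' => critical_eq F' (coords A) z' b) = - 'D_(evec R b) (half_sqdist A).
  by apply/funext => y; rewrite crE; rewrite -[LHS]opprK -derive_half_sqdist.
have rb := ratfun_deriveT (evec R b) (ratfun_half_sqdist A).
rewrite deriveN; last exact: (ratfun_derivable rb).
rewrite {1}(row_evec v) (ratfun_derive_linear _ _ rb) //.
move/rowP/(_ b): vH; rewrite !mxE => e; apply/eqP; rewrite oppr_eq0 -[X in _ == X]e.
by apply/eqP/eq_bigr => a _; rewrite !mxE.
Qed.

End HalfSquareDistance.

(** * Cayley charts *)

Section CayleyChart.
Variable R : realFieldType.

(** If [v] kills the matrix on the left, pairing with [v^T] removes the skew part and leaves a sum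
    of squares, so [v *m K^T = 0]. Multiplying by [E] recovers [v] itself. *)
Lemma posdef_unit (n t : nat) (K : 'M[R]_(n, t)) (E : 'M[R]_(n, t)) (Om : 'M[R]_t) :
  E^T *m K = 1%:M -> Om^T = - Om -> K^T *m K - Om \in unitmx.
Proof.
move=> EK skew; rewrite -row_free_unit -kermx_eq0; apply/rowV0P => v /sub_kermxP vM.
have vO : v *m Om *m v^T = 0.
  have : (v *m Om *m v^T)^T = - (v *m Om *m v^T).
    by rewrite !trmx_mul trmxK skew mulNmx mulmxN mulmxA.
  move: (v *m Om *m v^T) => S /matrixP e; apply/matrixP => i j; have := e j i.
  by rewrite !mxE !ord1; lra.
have vK : v *m K^T *m (v *m K^T)^T = 0.
  rewrite trmx_mul trmxK mulmxA -(mulmxA v); move: vM; rewrite mulmxBr => /eqP.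
  by rewrite subr_eq0 => /eqP ->.
have vK0 : v *m K^T = 0.
  apply/rowP => a; rewrite [RHS]mxE; move/matrixP/(_ 0 0): vK; rewrite mxE [RHS]mxE => /eqP.
  rewrite psumr_eq0 => [/allP/(_ a (mem_index_enum a))/=|b _]; last first.
    by rewrite [_^T _ _]mxE -expr2 sqr_ge0.
  by rewrite [_^T _ _]mxE mulf_eq0 orbb => /eqP.
have : v *m K^T *m E = v by rewrite -mulmxA -[E]trmxK -trmx_mul EK trmx1 mulmx1.
by move=> <-; rewrite vK0 mul0mx.
Qed.

Variables (n t : nat).
Implicit Types (E X Y : 'M[R]_(n, t)).

(* The matrices [X] and [Y] are related by [X + E = 2 K M^-1], where [K = cay_frame E Y] satisfies
   [E^T K = 1] and [M = cay_den E Y] has symmetric part [K^T K].  Conversely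
   [M = 2 (1 + E^T X)^-1] and [K = (X + E) (1 + E^T X)^-1].  Inverses are written with the
   adjugate so that the entries are visibly rational. *)
Definition cay_skew E Y : 'M[R]_t := E^T *m Y - Y^T *m E.
Definition cay_frame E Y : 'M[R]_(n, t) := E + (Y - E *m (E^T *m Y)).
Definition cay_den E Y : 'M[R]_t := (cay_frame E Y)^T *m cay_frame E Y - cay_skew E Y.
Definition cay E Y : 'M[R]_(n, t) :=
  (2 / \det (cay_den E Y)) *: (cay_frame E Y *m \adj (cay_den E Y)) - E.

Definition log_den E X : 'M[R]_t := 1%:M + E^T *m X.
Definition log_frame E X : 'M[R]_(n, t) :=
  (\det (log_den E X))^-1 *: ((X + E) *m \adj (log_den E X)).
Definition log_skew E X : 'M[R]_t :=
  (log_frame E X)^T *m log_frame E X - (2 / \det (log_den E X)) *: \adj (log_den E X).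

Lemma invmx_adj m (M : 'M[R]_m) : M \in unitmx -> (\det M)^-1 *: \adj M = invmx M.
Proof. by move=> uM; rewrite /invmx uM. Qed.

Lemma cay_skew_tr E Y : (cay_skew E Y)^T = - cay_skew E Y.
Proof. by rewrite /cay_skew linearB /= !trmx_mul !trmxK opprB. Qed.

Section OrthonormalFrame.
Variable E : 'M[R]_(n, t).
Hypothesis EE : E^T *m E = 1%:M.

Lemma cay_frameE Y : E^T *m cay_frame E Y = 1%:M.
Proof. by rewrite /cay_frame mulmxDr mulmxBr !mulmxA EE mul1mx subrr addr0. Qed.

Lemma cay_den_unit Y : cay_den E Y \in unitmx.
Proof. exact: (posdef_unit (cay_frameE Y) (cay_skew_tr E Y)). Qed.

Lemma cayE Y : cay E Y = 2 *: (cay_frame E Y *m invmx (cay_den E Y)) - E.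
Proof. by rewrite /cay -invmx_adj ?cay_den_unit // -scalemxAr scalerA. Qed.

Lemma log_den_cay Y : log_den E (cay E Y) = 2 *: invmx (cay_den E Y).
Proof.
by rewrite /log_den cayE mulmxBr -scalemxAr mulmxA cay_frameE mul1mx EE addrC subrK.
Qed.

Lemma log_den_cay_unit Y : log_den E (cay E Y) \in unitmx.
Proof.
by rewrite log_den_cay unitmxZ ?unitmx_inv ?cay_den_unit // unitfE pnatr_eq0.
Qed.

(** With [W = M^-1] and [X = 2 K W - E], the product [X^T X] is [4 W^T K^T K W - 2 (W + W^T) + 1].
    Since [2 K^T K = M + M^T], the first two terms cancel. *)
Lemma cay_stiefel Y : (cay E Y)^T *m cay E Y = 1%:M.
Proof.
set M := cay_den E Y; set K := cay_frame E Y; pose W := invmx M.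
have uM : M \in unitmx := cay_den_unit Y.
have KE : K^T *m E = 1%:M by rewrite -[E]trmxK -trmx_mul cay_frameE trmx1.
have symM : K^T *m K + K^T *m K = M + M^T.
  have -> : M^T = K^T *m K + cay_skew E Y.
    by rewrite /M /cay_den [LHS]linearB /= cay_skew_tr trmx_mul trmxK opprK.
  by rewrite /M /cay_den addrACA addNr addr0.
have eW : W^T *m (K^T *m K) *m W + W^T *m (K^T *m K) *m W = W + W^T.
  rewrite -mulmxDl -mulmxDr symM mulmxDr mulmxDl -mulmxA mulmxV // mulmx1.
  by rewrite -trmx_mul mulmxV // trmx1 mul1mx addrC.
have EKW : E^T *m (K *m W) = W by rewrite mulmxA cay_frameE mul1mx.
have KWE : (K *m W)^T *m E = W^T by rewrite trmx_mul -mulmxA KE mulmx1.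
rewrite cayE -/K -/M -/W.
have -> : (2 *: (K *m W) - E)^T = 2 *: (K *m W)^T - E^T by rewrite linearB linearZ.
rewrite mulmxBl !mulmxBr.
rewrite -!scalemxAl -!scalemxAr EKW KWE EE trmx_mul -mulmxA (mulmxA K^T) (mulmxA W^T).
set Q := W^T *m _ *m W in eW *.
have -> : 2 *: (2 *: Q) = 2 *: (W + W^T) by rewrite -eW !scaler_nat -mulr2n.
rewrite scalerDr addrAC opprB addrA; apply/matrixP => i j; rewrite !mxE; ring.
Qed.

Lemma log_frame_cay Y : log_frame E (cay E Y) = cay_frame E Y.
Proof.
rewrite /log_frame scalemxAr invmx_adj ?log_den_cay_unit // log_den_cay cayE subrK.
rewrite invmxZ ?unitmx_inv ?cay_den_unit //; last first.
  by rewrite unitmxZ ?unitmx_inv ?cay_den_unit // unitfE pnatr_eq0.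
rewrite invmxK -scalemxAl -scalemxAr scalerA mulfV ?pnatr_eq0 // scale1r.
by rewrite mulmxKV // cay_den_unit.
Qed.

Lemma log_skew_cay Y : log_skew E (cay E Y) = cay_skew E Y.
Proof.
rewrite /log_skew log_frame_cay -scalerA invmx_adj ?log_den_cay_unit // log_den_cay.
rewrite invmxZ ?unitmx_inv ?cay_den_unit //; last first.
  by rewrite unitmxZ ?unitmx_inv ?cay_den_unit // unitfE pnatr_eq0.
rewrite invmxK scalerA mulfV ?pnatr_eq0 // scale1r /cay_den opprB addrC subrK //.
Qed.

Section Log.
Variable X : 'M[R]_(n, t).
Hypotheses (XX : X^T *m X = 1%:M) (uX : log_den E X \in unitmx).

Lemma log_frameE : log_frame E X = (X + E) *m invmx (log_den E X).
Proof. by rewrite /log_frame scalemxAr invmx_adj. Qed.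

Lemma log_frame_orth : E^T *m log_frame E X = 1%:M.
Proof. by rewrite log_frameE mulmxA mulmxDr EE addrC mulmxV. Qed.

Lemma log_skewE : log_skew E X =
  (log_frame E X)^T *m log_frame E X - 2 *: invmx (log_den E X).
Proof. by rewrite /log_skew -scalerA invmx_adj. Qed.

(** Both frames are orthonormal, so [(X + E)^T (X + E) = T + T^T] for [T = log_den E X]. With
    [W = T^-1] the Gram matrix of [log_frame] is [W + W^T], and subtracting [2 W] leaves the skew
    matrix [W^T - W]. *)
Lemma log_skew_tr : (log_skew E X)^T = - log_skew E X.
Proof.
set T := log_den E X; pose W := invmx T.
have eT : (X + E)^T *m (X + E) = T + T^T.
  have tT : T^T = 1%:M + X^T *m E by rewrite /T /log_den [LHS]linearD /= trmx1 trmx_mul trmxK.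
  have -> : (X + E)^T = X^T + E^T by rewrite linearD.
  rewrite tT /T /log_den mulmxDl !mulmxDr XX EE.
  by move: (X^T *m E) (E^T *m X) => P Q; apply/matrixP => i j; rewrite !mxE; ring.
have eQ : (log_frame E X)^T *m log_frame E X = W + W^T.
  rewrite log_frameE trmx_mul -mulmxA [_ *m (_ *m invmx _)]mulmxA eT -/T -/W.
  rewrite mulmxDl mulmxDr mulmxV // mulmx1 mulmxA -trmx_mul mulmxV // trmx1 mul1mx.
  by rewrite addrC.
rewrite log_skewE eQ -/T -/W !linearB linearD linearZ /= trmxK.
by apply/matrixP => i j; rewrite !mxE; ring.
Qed.

Lemma cay_of_log Y : cay_frame E Y = log_frame E X -> cay_skew E Y = log_skew E X ->
  cay E Y = X.
Proof.
move=> eK eO.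
have eM : cay_den E Y = 2 *: invmx (log_den E X).
  by rewrite /cay_den eK eO log_skewE opprB addrC subrK.
rewrite cayE eM eK invmxZ ?unitmx_inv //; last first.
  by rewrite unitmxZ ?unitmx_inv // unitfE pnatr_eq0.
rewrite invmxK -scalemxAr scalerA mulfV ?pnatr_eq0 // scale1r log_frameE mulmxKV //.
by rewrite addrK.
Qed.

End Log.
End OrthonormalFrame.
End CayleyChart.

Section RationalMatrices.
Variables (R : realType) (p q : nat) (D : set 'M[R]_(p, q)).

Definition rat_mx (a b : nat) (F : 'M[R]_(p, q) -> 'M[R]_(a, b)) :=
  forall i j, ratfun D (fun X => F X i j).

Lemma rat_mx_cst a b (C : 'M[R]_(a, b)) : rat_mx (fun _ => C).
Proof. by move=> i j; exact: ratfun_cst. Qed.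

Lemma rat_mx_id : rat_mx id.
Proof. by move=> i j; exact: ratfun_coord. Qed.

Lemma rat_mxD a b (F G : 'M[R]_(p, q) -> 'M[R]_(a, b)) :
  rat_mx F -> rat_mx G -> rat_mx (fun X => F X + G X).
Proof.
move=> hF hG i j; rewrite (_ : (fun X => _) = (fun X => F X i j + G X i j)).
  exact: ratfunD.
by apply/funext => X; rewrite mxE.
Qed.

Lemma rat_mxB a b (F G : 'M[R]_(p, q) -> 'M[R]_(a, b)) :
  rat_mx F -> rat_mx G -> rat_mx (fun X => F X - G X).
Proof.
move=> hF hG i j; rewrite (_ : (fun X => _) = (fun X => F X i j - G X i j)).
  exact: ratfunB.
by apply/funext => X; rewrite !mxE.
Qed.

Lemma rat_mx_tr a b (F : 'M[R]_(p, q) -> 'M[R]_(a, b)) :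
  rat_mx F -> rat_mx (fun X => (F X)^T).
Proof.
move=> hF i j; rewrite (_ : (fun X => _) = (fun X => F X j i)) //.
by apply/funext => X; rewrite mxE.
Qed.

Lemma rat_mxZ a b f (F : 'M[R]_(p, q) -> 'M[R]_(a, b)) :
  ratfun D f -> rat_mx F -> rat_mx (fun X => f X *: F X).
Proof.
move=> hf hF i j; rewrite (_ : (fun X => _) = (fun X => f X * F X i j)).
  exact: ratfunM.
by apply/funext => X; rewrite mxE.
Qed.

Lemma rat_mxM a b c (F : 'M[R]_(p, q) -> 'M[R]_(a, b)) (G : 'M[R]_(p, q) -> 'M[R]_(b, c)) :
  rat_mx F -> rat_mx G -> rat_mx (fun X => F X *m G X).
Proof. by move=> hF hG i j; exact: ratfun_mulmx. Qed.

Lemma rat_mx_adj a (F : 'M[R]_(p, q) -> 'M[R]_a) :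
  rat_mx F -> rat_mx (fun X => \adj (F X)).
Proof. by move=> hF i j; exact: ratfun_adj. Qed.

End RationalMatrices.

Section SignedFrames.
Variables (R : realType) (n t : nat).
Hypothesis tn : (t <= n)%N.
Implicit Types (eps : 'I_t -> bool) (X Y : 'M[R]_(n, t)).

Definition signed_frame eps : 'M[R]_(n, t) :=
  \matrix_(a, j) if (a == j :> nat) then (-1) ^+ eps j else 0.

Let w : 'I_t -> 'I_n := widen_ord tn.

Let sgn2 (b : bool) (x : R) : (-1) ^+ b * ((-1) ^+ b * x) = x.
Proof. by rewrite mulrA -expr2 sqrr_sign mul1r. Qed.

Lemma signed_frame_trmul eps m (Z : 'M[R]_(n, m)) j l :
  ((signed_frame eps)^T *m Z) j l = (-1) ^+ eps j * Z (w j) l.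
Proof.
rewrite mxE (bigD1 (w j)) //= !mxE eqxx big1 ?addr0 // => a aj.
rewrite !mxE; have -> : (nat_of_ord a == j) = (a == w j) by [].
by rewrite (negbTE aj) mul0r.
Qed.

Lemma signed_frame_mul eps m (Z : 'M[R]_(t, m)) j l :
  (signed_frame eps *m Z) (w j) l = (-1) ^+ eps j * Z j l.
Proof.
rewrite mxE (bigD1 j) //= !mxE eqxx big1 ?addr0 // => a aj.
rewrite !mxE /=; have -> : (nat_of_ord j == a) = (j == a) by [].
by rewrite eq_sym (negbTE aj) mul0r.
Qed.

Lemma signed_frame_mul_out eps m (Z : 'M[R]_(t, m)) (a : 'I_n) l : (t <= a)%N ->
  (signed_frame eps *m Z) a l = 0.
Proof.
move=> ta; rewrite mxE big1 // => j _; rewrite !mxE.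
by case: eqP => [e|_]; [move: (ltn_ord j); rewrite -e ltnNge ta | rewrite mul0r].
Qed.

Lemma signed_frame_orth eps : (signed_frame eps)^T *m signed_frame eps = 1%:M.
Proof.
apply/matrixP => j l; rewrite signed_frame_trmul !mxE /=.
have -> : (nat_of_ord j == nat_of_ord l) = (j == l) by [].
case: eqVneq => [->|]; last by rewrite mulr0.
by rewrite -expr2 sqrr_sign.
Qed.

(** The free entries are one half of a skew [t x t] block and the whole block below it:
    [n t - t (t + 1) / 2] in number, the dimension of the Stiefel manifold. *)
Definition strictly_lower Y := forall (a : 'I_n) (j : 'I_t), (a <= j)%N -> Y a j = 0.

(** Rows with index below [t] (tested by [insub]) are read from the skew part, with the sign of the
    frame undone; the remaining rows are read from [log_frame]. *)
Definition lower_log eps X : 'M[R]_(n, t) :=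
  let E := signed_frame eps in
  \matrix_(a, j) if (a <= j)%N then 0 else
    if insub (a : nat) is Some i then (-1) ^+ eps i * log_skew E X i j else log_frame E X a j.

Lemma strictly_lower_log eps X : strictly_lower (lower_log eps X).
Proof. by move=> a j aj; rewrite mxE aj. Qed.

Lemma cay_skew_signed eps Y i j : cay_skew (signed_frame eps) Y i j =
  (-1) ^+ eps i * Y (w i) j - (-1) ^+ eps j * Y (w j) i.
Proof.
rewrite /cay_skew mxE signed_frame_trmul; congr (_ + _).
rewrite mxE -signed_frame_trmul -[signed_frame eps in LHS]trmxK -trmx_mul.
by congr (- _); rewrite mxE.
Qed.

Lemma row_cases (a : 'I_n) : (exists i : 'I_t, a = w i) \/ (t <= a)%N.
Proof.
have [ta|ta] := ltnP a t; last by right.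
by left; exists (Ordinal ta); exact: val_inj.
Qed.

Lemma insub_w i : insub (w i : nat) = Some i :> option 'I_t.
Proof. by rewrite /= valK. Qed.

Lemma lower_log_cay eps Y : strictly_lower Y -> lower_log eps (cay (signed_frame eps) Y) = Y.
Proof.
move=> lY; have EE := signed_frame_orth eps.
apply/matrixP => a j; rewrite mxE; case: leqP => [aj|ja]; first by rewrite lY.
have [[i ei]|ta] := row_cases a.
  rewrite ei insub_w log_skew_cay // cay_skew_signed.
  by rewrite [Y (w j) i]lY ?mulr0 ?subr0 ?sgn2 //= ltnW //; move: ja; rewrite ei.
rewrite insubF; last by rewrite ltnNge ta.
rewrite log_frame_cay // /cay_frame mxE [X in _ + X]mxE [X in _ + (_ + X)]mxE.
by rewrite signed_frame_mul_out // subr0 mxE gtn_eqF // add0r.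
Qed.

(** The lower entries suffice: the top block of the frame is forced by [E^T K = 1], and the upper
    half of the skew part follows from the lower half. *)
Lemma cay_lower_log eps X : X^T *m X = 1%:M -> log_den (signed_frame eps) X \in unitmx ->
  cay (signed_frame eps) (lower_log eps X) = X.
Proof.
move=> XX uX; have EE := signed_frame_orth eps; set E := signed_frame eps.
have lw (i j : 'I_t) : lower_log eps X (w i) j =
    if (i <= j)%N then 0 else (-1) ^+ eps i * log_skew E X i j.
  by rewrite mxE insub_w.
apply: (cay_of_log EE uX).
- apply/matrixP => a j; rewrite /cay_frame mxE [X in _ + X]mxE [X in _ + (_ + X)]mxE.
  have [[i ->]|ta] := row_cases a.
    rewrite signed_frame_mul signed_frame_trmul sgn2 subrr addr0.
    have /matrixP/(_ i j) := log_frame_orth EE uX.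
    rewrite signed_frame_trmul [X in _ = X]mxE => e.
    rewrite -[RHS](sgn2 (eps i)) e mxE /=.
    have -> : (nat_of_ord i == nat_of_ord j) = (i == j) by [].
    by case: eqVneq => [->|_]; rewrite /= ?mulr1 ?mulr0.
  have ja : (j < a)%N by apply: leq_trans ta.
  rewrite signed_frame_mul_out // subr0 mxE gtn_eqF // add0r mxE leqNgt ja /=.
  by rewrite insubF // ltnNge ta.
- apply/matrixP => i j; rewrite cay_skew_signed !lw.
  have /matrixP/(_ i j) := log_skew_tr EE XX uX.
  rewrite mxE [RHS]mxE -/E => e.
  case: (ltngtP i j) => [ij|ji|/val_inj ij].
  + by rewrite mulr0 sub0r sgn2 e opprK.
  + by rewrite mulr0 subr0 sgn2.
  + by move: e; rewrite ij mulr0 subrr; lra.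
Qed.

(* The determinant is affine in each sign, and it is [1] if all rows of [X] are replaced by [0]. *)
Lemma exists_signed_frame X : exists eps, \det (log_den (signed_frame eps) X) != 0.
Proof.
pose B (c : 'I_t -> R) (m : nat) : 'M[R]_t :=
  \matrix_(i, j) ((i == j)%:R + (if (i < m)%N then c i else 0) * X (w i) j).
suff [eps h] : exists eps : 'I_t -> bool, \det (B (fun i => (-1) ^+ eps i) t) != 0.
  exists eps; congr (\det _ != 0) : h; apply/matrixP => i j.
  by rewrite mxE ltn_ord [RHS]mxE signed_frame_trmul mxE.
suff H m : (m <= t)%N -> exists eps : 'I_t -> bool, \det (B (fun i => (-1) ^+ eps i) m) != 0.
  exact: H.
elim: m => [|m IH] mt.
  exists (fun _ => false); rewrite (_ : B _ _ = 1%:M) ?det1 ?oner_neq0 //.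
  by apply/matrixP => i j; rewrite !mxE ltn0 mul0r addr0.
have [eps h] := IH (ltnW mt); pose k : 'I_t := Ordinal mt.
pose c (b : bool) (i : 'I_t) : R := (-1) ^+ (if i == k then b else eps i).
pose Z : 'M[R]_t := \matrix_(i, j) if i == k then X (w k) j else B (fun i => (-1) ^+ eps i) m i j.
have Bk b : \det (B (c b) m.+1) = 1 * \det (B (fun i => (-1) ^+ eps i) m) + (-1) ^+ b * \det Z.
  have off (i : 'I_t) j : i != k ->
      B (c b) m.+1 i j = B (fun i => (-1) ^+ eps i) m i j.
    move=> ik; rewrite !mxE /c (negbTE ik) ltnS leq_eqVlt.
    by have -> : (nat_of_ord i == m) = (i == k) by []; rewrite (negbTE ik).
  have lk i : lift k i != k by rewrite eq_sym neq_lift.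
  apply: (determinant_multilinear (i0 := k)).
  - by apply/rowP => j; rewrite !mxE eqxx /c eqxx /= ltnSn ltnn mul0r addr0 mul1r.
  - by apply/matrixP => i j; rewrite [LHS]mxE [RHS]mxE off.
  - apply/matrixP => i j; rewrite [LHS]mxE [RHS]mxE off // mxE.
    by rewrite (negbTE (lk i)).
have [b hb] : exists b, \det (B (c b) m.+1) != 0.
  have [e0|] := eqVneq (\det (B (c true) m.+1)) 0; last by exists true.
  exists false; rewrite Bk; move: e0; rewrite Bk expr1 expr0 !mul1r => e0.
  by apply: contra_neq h => e1; lra.
by exists (fun i => if i == k then b else eps i).
Qed.

Lemma rat_mx_cay_den D (E : 'M[R]_(n, t)) : rat_mx D (fun Y => cay_den E Y).
Proof.
have hK : rat_mx D (fun Y => cay_frame E Y).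
  by apply: rat_mxD; [exact: rat_mx_cst | apply: rat_mxB; [exact: rat_mx_id |
     apply: rat_mxM; [exact: rat_mx_cst | apply: rat_mxM; [exact: rat_mx_cst | exact: rat_mx_id]]]].
apply: rat_mxB; first by apply: rat_mxM => //; exact: rat_mx_tr.
apply: rat_mxB; first by apply: rat_mxM; [exact: rat_mx_cst | exact: rat_mx_id].
by apply: rat_mxM; [apply: rat_mx_tr; exact: rat_mx_id | exact: rat_mx_cst].
Qed.

Lemma rat_mx_cay eps : rat_mx setT (fun Y => cay (signed_frame eps) Y).
Proof.
have EE := signed_frame_orth eps; set E := signed_frame eps.
have hM := @rat_mx_cay_den setT E.
apply: rat_mxB; last exact: rat_mx_cst.
apply: rat_mxZ.
  apply: ratfunM; first exact: ratfun_cst.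
  apply: ratfunV; last exact: ratfun_det.
  by move=> Y _; have := cay_den_unit EE Y; rewrite unitmxE unitfE.
apply: rat_mxM; last exact: rat_mx_adj.
by apply: rat_mxD; [exact: rat_mx_cst | apply: rat_mxB; [exact: rat_mx_id |
     apply: rat_mxM; [exact: rat_mx_cst | apply: rat_mxM; [exact: rat_mx_cst | exact: rat_mx_id]]]].
Qed.

Lemma rat_mx_log_den D (E : 'M[R]_(n, t)) : rat_mx D (fun X => log_den E X).
Proof.
by apply: rat_mxD; [exact: rat_mx_cst | apply: rat_mxM; [exact: rat_mx_cst | exact: rat_mx_id]].
Qed.

Lemma rat_mx_lower_log eps :
  rat_mx [set X | \det (log_den (signed_frame eps) X) != 0] (lower_log eps).
Proof.
set E := signed_frame eps; set D := mkset _.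
have hV : ratfun D (fun X => (\det (log_den E X))^-1).
  by apply: ratfunV => //; apply: ratfun_det; exact: rat_mx_log_den.
have hF : rat_mx D (fun X => log_frame E X).
  apply: rat_mxZ => //; apply: rat_mxM; last by apply: rat_mx_adj; exact: rat_mx_log_den.
  by apply: rat_mxD; [exact: rat_mx_id | exact: rat_mx_cst].
have hS : rat_mx D (fun X => log_skew E X).
  apply: rat_mxB; first by apply: rat_mxM => //; exact: rat_mx_tr.
  apply: rat_mxZ; first by apply: ratfunM => //; exact: ratfun_cst.
  by apply: rat_mx_adj; exact: rat_mx_log_den.
move=> a j; rewrite (_ : (fun X => _) = (fun X => if (a <= j)%N then 0 else
    if insub (a : nat) is Some i then (-1) ^+ eps i * log_skew E X i j else log_frame E X a j)).
  case: (a <= j)%N; first exact: ratfun_cst.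
  case: insubP => [i _ _|_]; last exact: hF.
  by apply: ratfunM; [exact: ratfun_cst | exact: hS].
by apply/funext => X; rewrite mxE.
Qed.

End SignedFrames.

Section FactorChart.
Variables (R : realType) (n t : nat) (b : bool).
Hypotheses (tn : (t <= n)%N) (n0 : (0 < n)%N).
Implicit Types (eps : 'I_t -> bool) (X Y : 'M[R]_(n, t)).

Let fr1 eps (j : 'I_t) : 'M[R]_(n, 1) := signed_frame R n (fun _ : 'I_1 => eps j).

(* An oblique factor is parametrized column by column, a unit vector being a Stiefel matrix
   with one column. *)
Definition fchart eps Y : 'M[R]_(n, t) :=
  if b then cay (signed_frame R n eps) Y else \matrix_(a, j) cay (fr1 eps j) (col j Y) a 0.

Definition flog eps X : 'M[R]_(n, t) :=
  if b then lower_log eps X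
  else \matrix_(a, j) lower_log (fun _ : 'I_1 => eps j) (col j X) a 0.

Definition fden eps X : R :=
  if b then \det (log_den (signed_frame R n eps) X)
  else \prod_j \det (log_den (fr1 eps j) (col j X)).

(** The strictly lower pattern of the Stiefel chart; for a unit column it is the pattern with
    [t = 1], which fixes only row [0]. *)
Definition fvalid (a : 'I_n) (j : 'I_t) : bool := if b then (j < a)%N else (0 < a)%N.

Definition fvar X : Prop := if b then stiefel X else unit_cols X.

Definition fvanish Y := forall a j, ~~ fvalid a j -> Y a j = 0.

Lemma col_stiefel X j :
  \sum_(a < n) X a j ^+ 2 = 1 <-> (col j X)^T *m col j X = 1%:M.
Proof.
have e : ((col j X)^T *m col j X) 0 0 = \sum_(a < n) X a j ^+ 2.
  by rewrite mxE; apply: eq_bigr => a _; rewrite !mxE expr2.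
split=> [h|h]; last by rewrite -e h mxE.
by apply/matrixP => i i'; rewrite !ord1 e h mxE.
Qed.

Lemma fvar_fchart eps Y : fvar (fchart eps Y).
Proof.
rewrite /fvar /fchart; case: b; first by rewrite /stiefel; apply: cay_stiefel; exact: signed_frame_orth.
move=> j; rewrite -[RHS](_ : \sum_(a < n) (cay (fr1 eps j) (col j Y)) a 0 ^+ 2 = 1).
  by apply: eq_bigr => a _; rewrite mxE.
have := cay_stiefel (signed_frame_orth R n0 (fun _ : 'I_1 => eps j)) (col j Y).
move/matrixP/(_ 0 0); rewrite mxE [RHS]mxE eqxx => e; rewrite -[RHS]e.
by apply: eq_bigr => a _; rewrite [_^T _ _]mxE expr2.
Qed.

Lemma col_fchart eps Y j : b = false -> col j (fchart eps Y) = cay (fr1 eps j) (col j Y).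
Proof. by rewrite /fchart => ->; apply/matrixP => a i; rewrite !mxE ord1. Qed.

Lemma flog_fchart eps Y : fvanish Y -> flog eps (fchart eps Y) = Y.
Proof.
rewrite /fvanish /fvalid /flog => hY; case E: b hY => hY.
  rewrite /fchart E; apply: lower_log_cay => // a j aj; apply: hY; by rewrite -leqNgt.
apply/matrixP => a j; rewrite mxE col_fchart // lower_log_cay ?mxE //.
move=> a' i; rewrite !ord1 leqn0 mxE => /eqP a0; apply: hY; by rewrite a0.
Qed.

Lemma fden_neq0 eps X : fden eps X != 0 ->
  if b then is_true (log_den (signed_frame R n eps) X \in unitmx)
  else forall j, log_den (fr1 eps j) (col j X) \in unitmx.
Proof.
rewrite /fden; case: b; first by rewrite unitmxE unitfE.
by move/prodf_neq0 => h j; rewrite unitmxE unitfE h.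
Qed.

Lemma fchart_flog eps X : fvar X -> fden eps X != 0 -> fchart eps (flog eps X) = X.
Proof.
rewrite /fvar => vX /fden_neq0 dX; rewrite /fchart /flog; case: b vX dX => vX dX.
  exact: cay_lower_log.
apply/matrixP => a j; rewrite mxE.
have -> : col j (\matrix_(a, j) lower_log (fun _ : 'I_1 => eps j) (col j X) a 0) =
   lower_log (fun _ : 'I_1 => eps j) (col j X).
  by apply/matrixP => a' i; rewrite !mxE !ord1 //= mxE.
by rewrite cay_lower_log; [rewrite mxE | exact: n0 | apply/(col_stiefel X j); exact: vX | exact: dX].
Qed.

Lemma fvanish_flog eps X : fvanish (flog eps X).
Proof.
rewrite /fvanish /fvalid /flog => a j; case: b.
  by rewrite -leqNgt => aj; rewrite strictly_lower_log.
by rewrite -leqNgt leqn0 mxE => /eqP a0; rewrite strictly_lower_log // a0.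
Qed.

Lemma fden_fchart eps Y : fden eps (fchart eps Y) != 0.
Proof.
have u1 := log_den_cay_unit (signed_frame_orth R tn eps) Y.
rewrite /fden; case E: b; first by rewrite /fchart E; move: u1; rewrite unitmxE unitfE.
apply/prodf_neq0 => j _; rewrite col_fchart //.
have := log_den_cay_unit (signed_frame_orth R n0 (fun _ : 'I_1 => eps j)) (col j Y).
by rewrite unitmxE unitfE.
Qed.

Lemma exists_fden X : exists eps : {ffun 'I_t -> bool}, fden eps X != 0.
Proof.
rewrite /fden; case: b.
  have [eps h] := exists_signed_frame tn X; exists [ffun j => eps j].
  by rewrite (_ : (fun_of_fin _ : 'I_t -> bool) = eps) //; apply/funext => j; rewrite ffunE.
have /choice[eps h] : forall j, exists e : bool,
    \det (log_den (signed_frame R n (fun _ : 'I_1 => e)) (col j X)) != 0.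
  move=> j; have [eps h] := exists_signed_frame n0 (col j X); exists (eps 0).
  by rewrite (_ : (fun _ => _) = eps) //; apply/funext => i; rewrite ord1.
exists [ffun j => eps j]; apply/prodf_neq0 => j _; rewrite /fr1 ffunE; exact: h.
Qed.

Lemma rat_mx_col D j : rat_mx D (fun X => col j X).
Proof.
move=> a i; rewrite (_ : (fun X => _) = (fun X : 'M[R]_(n, t) => X a j)).
  exact: ratfun_coord.
by apply/funext => X; rewrite mxE.
Qed.

Lemma rat_mx_fchart eps : rat_mx setT (fchart eps).
Proof.
rewrite /fchart; case: b; first exact: rat_mx_cay.
move=> a j; rewrite (_ : (fun Y => _) = (fun Y => cay (fr1 eps j) (col j Y) a 0)); last first.
  by apply/funext => Y; rewrite mxE.
by apply: (ratfun_comp (h := fun Y : 'M[R]_(n, t) => col j Y) (rat_mx_cay R n0 (fun _ : 'I_1 => eps j) a 0)) => //; exact: rat_mx_col.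
Qed.

Lemma ratfun_fden eps : ratfun setT (fden eps).
Proof.
rewrite /fden; case: b; first by apply: ratfun_det; exact: rat_mx_log_den.
apply: ratfun_prod => j _.
have h : ratfun setT (fun X : 'cV[R]_n => \det (log_den (fr1 eps j) X)).
  by apply: ratfun_det; exact: rat_mx_log_den.
exact: (ratfun_comp (h := fun X : 'M[R]_(n, t) => col j X) h (rat_mx_col setT j) (fun _ _ => Logic.I)).
Qed.

Lemma rat_mx_flog eps : rat_mx [set X | fden eps X != 0] (flog eps).
Proof.
rewrite /fden /flog; case: b; first exact: rat_mx_lower_log.
move=> a j; rewrite (_ : (fun X => _) =
    (fun X => lower_log (fun _ : 'I_1 => eps j) (col j X) a 0)); last first.
  by apply/funext => X; rewrite mxE.
have h := @rat_mx_lower_log R n 1 (fun _ : 'I_1 => eps j) a 0.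
apply: (ratfun_comp (h := fun X : 'M[R]_(n, t) => col j X) h (rat_mx_col _ j)).
by move=> X /= /prodf_neq0; apply.
Qed.

End FactorChart.

Section MatrixContinuity.
Variable R : realType.

Lemma finite_modulus (T : finType) (P : T -> R -> Prop) :
  (forall u d d', d' <= d -> P u d -> P u d') ->
  (forall u, exists2 d, 0 < d & P u d) -> exists2 d, 0 < d & forall u, P u d.
Proof.
move=> mono h; have [dd [d0 hd]] : exists dd : T -> R,
  (forall u, 0 < dd u) /\ (forall u, P u (dd u)).
  have /choice[dd hdd] : forall u, exists d, 0 < d /\ P u d.
    by move=> u; have [d d0 Pd] := h u; exists d.
  by exists dd; split=> u; case: (hdd u).
exists (\big[Num.min/1]_u dd u).
  by apply/bigmin_gtP; split=> // u _; exact: d0.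
move=> u; apply: mono (hd u); exact: (@bigmin_le_cond _ _ _ _ u predT).
Qed.

Lemma mx_norm_lt (m n : nat) (M : 'M[R]_(m, n)) e : 0 < e ->
  (`|M| < e) <-> (forall i j, `|M i j| < e).
Proof.
move=> e0; have -> : `|M| = \big[Num.max/0]_ij `|M ij.1 ij.2| := mx_normrE M.
split=> [h i j|h].
  by apply: le_lt_trans h; exact: (le_bigmax _ (fun ij => `|M ij.1 ij.2|) (i, j)).
by apply/bigmax_ltP; split=> // -[i j] _; exact: h.
Qed.

Lemma ball0_norm (m n : nat) (M : 'M[R]_(m, n)) d : ball (0 : 'M[R]_(m, n)) d M <-> `|M| < d.
Proof. by rewrite mx_norm_ball /ball_ /= sub0r normrN. Qed.

Variables (p q : nat).

Lemma rat_mx_modulus (D : set 'M[R]_(p, q)) a b (F : 'M[R]_(p, q) -> 'M[R]_(a, b)) X e :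
  rat_mx D F -> D X -> 0 < e ->
  exists2 d, 0 < d & forall Y, `|Y - X| < d -> `|F Y - F X| < e.
Proof.
move=> hF DX e0.
have [|ij|d d0 hd] := @finite_modulus ('I_a * 'I_b)%type
  (fun ij d => 0 < d -> forall Y, `|Y - X| < d -> `|F Y ij.1 ij.2 - F X ij.1 ij.2| < e).
- move=> u d d' dd' h d'0 Y hY; apply: h; first exact: lt_le_trans dd'.
  exact: lt_le_trans hY dd'.
- have [d d0 h] := ratfun_modulus (hF ij.1 ij.2) DX e0.
  exists d => // _ Y /(mx_norm_lt _ d0) hY; apply: h => i j.
  by have := hY i j; rewrite !mxE.
- exists d => // Y hY; apply/mx_norm_lt => // i j.
  by have := hd (i, j) d0 Y hY; rewrite !mxE.
Qed.

Lemma rat_mx_derivable a b (F : 'M[R]_(p, q) -> 'M[R]_(a, b)) X v :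
  rat_mx setT F -> derivable F X v.
Proof. by move=> hF; apply/derivable_mxP => i j; exact: (ratfun_derivable (hF i j)). Qed.

Lemma rat_mx_deriveE a b (F : 'M[R]_(p, q) -> 'M[R]_(a, b)) X v i j :
  rat_mx setT F -> ('D_v F X) i j = 'D_v (fun Y => F Y i j) X.
Proof. by move=> hF; rewrite derive_mx ?mxE //; exact: rat_mx_derivable. Qed.

Lemma rat_mx_iterD a b (F : 'M[R]_(p, q) -> 'M[R]_(a, b)) vs :
  rat_mx setT F -> rat_mx setT (Defs.iterD F vs).
Proof.
move=> hF; elim: vs => [|v vs IH] //= i j.
rewrite (_ : (fun X => _) = 'D_v (fun Y => Defs.iterD F vs Y i j)).
  exact: ratfun_deriveT.
by apply/funext => X; rewrite rat_mx_deriveE.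
Qed.

Lemma rat_mx_continuous a b (F : 'M[R]_(p, q) -> 'M[R]_(a, b)) :
  rat_mx setT F -> continuous F.
Proof.
move=> hF X; apply/(@cvgrPdist_lt _ _ _ (nbhs X)) => e e0.
have [d d0 h] := rat_mx_modulus hF (Logic.I : setT X) e0.
apply/nbhs_ballP; exists d => // Y; rewrite -ball_normE /= distrC => hY.
by rewrite distrC; exact: h.
Qed.

Lemma rat_mx_smooth a b (F : 'M[R]_(p, q) -> 'M[R]_(a, b)) D :
  rat_mx setT F -> smooth_on D F.
Proof.
move=> hF vs; have hvs := rat_mx_iterD vs hF; split=> [X _ v|].
  exact: rat_mx_derivable.
by apply: continuous_subspaceT; exact: rat_mx_continuous.
Qed.

Lemma rat_mx_translate a b (F : 'M[R]_(p, q) -> 'M[R]_(a, b)) X :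
  rat_mx setT F -> rat_mx setT (fun Y => F (X + Y)).
Proof.
move=> hF i j; have h : rat_mx setT (fun Y : 'M[R]_(p, q) => X + Y).
  by apply: rat_mxD; [exact: rat_mx_cst | exact: rat_mx_id].
exact: (ratfun_comp (h := fun Y => X + Y) (hF i j) h (fun _ _ => Logic.I)).
Qed.

End MatrixContinuity.

(** * Charts of the whole parameter space *)

Section GlobalChart.
Variables (R : realType) (k : nat) (n : 'I_k -> nat) (s t : nat).
Hypotheses (tn : forall i, (t <= n i)%N) (n0 : forall i, (0 < n i)%N).
Variable eps : {ffun 'I_k -> {ffun 'I_t -> bool}}.

Definition entry := {i : 'I_k & ('I_(n i) * 'I_t)%type}.

Definition valid_entry (u : entry) : bool :=
  fvalid (tag u < s)%N (tagged u).1 (tagged u).2.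

(** Free entries of all factors, followed by the [t] weights. Every vector indexed by this type is
    admissible, so a chart is defined on a full coordinate space and membership in [W] remains an
    open condition on it. *)
Definition cidx : finType := ({u : entry | valid_entry u} + 'I_t)%type.

Definition chart_dim : nat := #|cidx|.

Definition coordU (z : 'rV[R]_chart_dim) : kpoint R n t := fun i =>
  \matrix_(a, j)
    if insub (Tagged (fun i => ('I_(n i) * 'I_t)%type) (a, j) : entry) is Some u
    then z 0 (enum_rank (inl u : cidx)) else 0.

Definition chartX (z : 'rV[R]_chart_dim) : 'rV[R]_t := \row_j z 0 (enum_rank (inr j : cidx)).

Definition chartU (z : 'rV[R]_chart_dim) : kpoint R n t := fun i =>
  fchart (i < s)%N (eps i) (coordU z i).

Definition assemble (Y : kpoint R n t) (x : 'rV[R]_t) : 'rV[R]_chart_dim :=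
  \row_e match enum_val e : cidx with
         | inl u => Y (tag (val u)) (tagged (val u)).1 (tagged (val u)).2
         | inr j => x 0 j
         end.

Definition chart_inv (U : kpoint R n t) (x : 'rV[R]_t) : 'rV[R]_chart_dim :=
  assemble (fun i => flog (i < s)%N (eps i) (U i)) x.

Definition in_chart (U : kpoint R n t) := forall i : 'I_k, fden (i < s)%N (eps i) (U i) != 0.

Definition in_variety (U : kpoint R n t) := forall i : 'I_k, fvar (i < s)%N (U i).

Lemma coordU_vanish z (i : 'I_k) : fvanish (i < s)%N (coordU z i).
Proof. by move=> a j h; rewrite mxE insubF //; exact: negbTE. Qed.

Lemma assemble_coord z : assemble (coordU z) (chartX z) = z.
Proof.
apply/rowP => e; rewrite mxE; case E: (enum_val e : cidx) => [u|j]; rewrite mxE.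
  have -> : insub (Tagged (fun i => ('I_(n i) * 'I_t)%type)
      ((tagged (val u)).1, (tagged (val u)).2) : entry) = Some u.
    have -> : Tagged (fun i => ('I_(n i) * 'I_t)%type)
      ((tagged (val u)).1, (tagged (val u)).2) = val u by case: u {E} => -[i [a j]] h.
    exact: valK.
  by rewrite -E enum_valK.
by rewrite -E enum_valK.
Qed.

Lemma coordU_assemble Y x (i : 'I_k) : fvanish (i < s)%N (Y i) -> coordU (assemble Y x) i = Y i.
Proof.
move=> vY; apply/matrixP => a j; rewrite mxE; case: insubP => [u _ e|nv].
  by rewrite mxE enum_rankK e.
by rewrite vY.
Qed.

Lemma chartX_assemble Y x : chartX (assemble Y x) = x.
Proof. by apply/rowP => j; rewrite !mxE enum_rankK. Qed.

Lemma chart_invK z : chart_inv (chartU z) (chartX z) = z.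
Proof.
rewrite -[RHS]assemble_coord /chart_inv; congr assemble.
apply: functional_extensionality_dep => i.
by rewrite flog_fchart //; exact: coordU_vanish.
Qed.

Lemma chartU_inv U x (i : 'I_k) : in_variety U -> in_chart U -> chartU (chart_inv U x) i = U i.
Proof.
move=> vU dU; rewrite /chartU coordU_assemble; last exact: fvanish_flog.
exact: fchart_flog.
Qed.

Lemma chartX_inv U x : chartX (chart_inv U x) = x.
Proof. exact: chartX_assemble. Qed.

Lemma chartU_in_variety z : in_variety (chartU z).
Proof. by move=> i; exact: fvar_fchart. Qed.

Lemma chartU_in_chart z : in_chart (chartU z).
Proof. by move=> i; exact: fden_fchart. Qed.

Lemma rat_mx_chartU (i : 'I_k) : rat_mx setT (fun z => chartU z i).
Proof.
move=> a j.
have h : rat_mx setT (fun z => coordU z i).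
  move=> a' j'; rewrite (_ : (fun z => _) = (fun z : 'rV[R]_chart_dim =>
    if insub (Tagged (fun i => ('I_(n i) * 'I_t)%type) (a', j') : entry) is Some u
    then z 0 (enum_rank (inl u : cidx)) else 0)); last by apply/funext => z; rewrite mxE.
  by case: insub => [u|]; [exact: ratfun_coord | exact: ratfun_cst].
exact: (ratfun_comp (h := fun z => coordU z i) (rat_mx_fchart R (i < s)%N (tn i) (n0 i) (eps i) a j) h
  (fun _ _ => Logic.I)).
Qed.

Lemma rat_mx_chartX : rat_mx setT chartX.
Proof.
move=> a j; rewrite (_ : (fun z => _) = (fun z : 'rV[R]_chart_dim => z 0 (enum_rank (inr j : cidx)))).
  exact: ratfun_coord.
by apply/funext => z; rewrite mxE.
Qed.

Lemma chart_inv_modulus U x e : in_chart U -> 0 < e ->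
  exists2 d, 0 < d & forall (U' : kpoint R n t) (x' : 'rV[R]_t),
    (forall i, `|U' i - U i| < d) -> `|x' - x| < d ->
    `|chart_inv U' x' - chart_inv U x| < e.
Proof.
move=> dU e0.
have [||d d0 hd] := @finite_modulus R _ (fun (i : 'I_k) d => 0 < d ->
   forall X, `|X - U i| < d ->
     `|flog (i < s)%N (eps i) X - flog (i < s)%N (eps i) (U i)| < e).
- move=> i d d' dd' h d'0 X hX; apply: h; first exact: lt_le_trans dd'.
  exact: lt_le_trans hX dd'.
- move=> i; have [d d0 h] := rat_mx_modulus (@rat_mx_flog R (n i) t (i < s)%N (eps i)) (dU i) e0.
  by exists d.
exists (Num.min d e) => [|U' x' hU hx]; first by rewrite lt_min d0.
apply/mx_norm_lt => // i c; rewrite !mxE; case: (enum_val c : cidx) => [u|j].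
  have hu : `|U' (tag (val u)) - U (tag (val u))| < d.
    by apply: lt_le_trans (hU _) _; rewrite ge_min lexx.
  have := hd _ d0 _ hu; move=> /(mx_norm_lt _ e0)/(_ (tagged (val u)).1 (tagged (val u)).2).
  by rewrite !mxE.
have : `|x' - x| < e by apply: lt_le_trans hx _; rewrite ge_min lexx orbT.
by move/(mx_norm_lt _ e0)/(_ 0 j); rewrite !mxE.
Qed.

Lemma in_chart_near U : in_chart U -> exists2 d, 0 < d & forall U' : kpoint R n t,
  (forall i, `|U' i - U i| < d) -> in_chart U'.
Proof.
move=> dU.
have [||d d0 hd] := @finite_modulus R _ (fun (i : 'I_k) d => 0 < d ->
   forall X, `|X - U i| < d -> fden (i < s)%N (eps i) X != 0).
- move=> i d d' dd' h d'0 X hX; apply: h; first exact: lt_le_trans dd'.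
  exact: lt_le_trans hX dd'.
- move=> i; have f0 : 0 < `|fden (i < s)%N (eps i) (U i)| by rewrite normr_gt0.
  have [d d0 h] := ratfun_modulus (@ratfun_fden R (n i) t (i < s)%N (eps i)) (Logic.I : setT (U i)) f0.
  exists d => // _ X /(mx_norm_lt _ d0) hX; apply/eqP => X0.
  have : `|fden (i < s)%N (eps i) X - fden (i < s)%N (eps i) (U i)| <
      `|fden (i < s)%N (eps i) (U i)|.
    by apply: h => a b; have := hX a b; rewrite !mxE.
  by rewrite X0 sub0r normrN ltxx.
by exists d => // U' hU i; exact: hd.
Qed.

(** Each coordinate of [z] is a rational function of the chart value, by the left inverse. If the
    chart is stationary along [c], then so is every coordinate, whose derivative is the entry of
    [c]. *)
Lemma chart_immersion z c :
  (forall i a j, 'D_c (fun y => chartU y i a j) z = 0) ->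
  (forall j, 'D_c (fun y => chartX y 0 j) z = 0) -> c = 0.
Proof.
move=> hU hX; apply/rowP => e; rewrite mxE.
have D1 : 'D_c (fun y : 'rV[R]_chart_dim => y 0 e) z = c 0 e.
  have := derive_mx (@derivable_id R 'rV[R]_chart_dim z c).
  by rewrite derive_id => /matrixP/(_ 0 e); rewrite mxE.
rewrite -D1; case E: (enum_val e : cidx) => [u|j].
  pose i := tag (val u); pose a := (tagged (val u)).1; pose j := (tagged (val u)).2.
  have -> : (fun y : 'rV[R]_chart_dim => y 0 e) =
      (fun y => flog (i < s)%N (eps i) (chartU y i) a j).
    by apply/funext => y; rewrite -{1}(chart_invK y) mxE E.
  have h := ratfun_chain0 (@rat_mx_flog R (n i) t (i < s)%N (eps i) a j) (h := fun y => chartU y i).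
  rewrite (@derive_val _ _ _ _ _ _ _ (h _ _ _ _)) //.
  - exact: chartU_in_chart.
  - move=> a' j'; apply: DeriveDef; last exact: hU.
    exact: (ratfun_derivable (rat_mx_chartU a' j')).
have -> // : (fun y : 'rV[R]_chart_dim => y 0 e) = (fun y => chartX y 0 j).
by apply/funext => y; rewrite mxE -E enum_valK.
Qed.

End GlobalChart.

(** Expresses full column rank by a polynomial that does not vanish, which makes the oblique
    condition open along rational charts. *)
Lemma rank_gram (R : realFieldType) (n t : nat) (X : 'M[R]_(n, t)) :
  (\rank X == t) = (\det (X^T *m X) != 0).
Proof.
rewrite -unitfE -unitmxE; apply/idP/idP => [rX|uX].
  have : row_free X^T by rewrite /row_free mxrank_tr.
  case/row_freeP => B XB.
  have BX : B^T *m X = 1%:M by rewrite -[X]trmxK -trmx_mul XB trmx1.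
  have := posdef_unit (K := X) (E := B) (Om := 0) BX; rewrite subr0; apply.
  by rewrite trmx0 oppr0.
rewrite eqn_leq rank_leq_col /=.
have := uX; rewrite -row_free_unit => /eqP {1}<-; exact: mxrankM_maxr.
Qed.

Lemma derive_translated_mx (R : realType) (d p q : nat) (F : 'rV[R]_d -> 'M[R]_(p, q)) z
    (c : 'rV[R]_d) i j : rat_mx setT F ->
  (\sum_b c 0 b *: 'D_(evec R b) (fun y => F (z + y)) 0) i j = 'D_c (fun y => F y i j) z.
Proof.
move=> hF; rewrite {2}(row_evec c) (ratfun_derive_linear _ _ (hF i j)) // summxE.
apply: eq_bigr => b _; rewrite mxE rat_mx_deriveE; last exact: rat_mx_translate.
by rewrite (derive_translate (fun y => F y i j)) addr0.
Qed.

Section LocalParam.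
Variables (R : realType) (k : nat) (n : 'I_k -> nat) (s t : nat).
Hypotheses (tn : forall i, (t <= n i)%N) (n0 : forall i, (0 < n i)%N).
Implicit Types (U : kpoint R n t) (x : 'rV[R]_t).

Lemma inW_in_variety U x : inW s U x -> in_variety s U.
Proof.
move=> [h1 [h2 _]] i; rewrite /fvar; case: ltnP => [/h1//|/h2[]//].
Qed.

(** On the variety, [W] is the nonvanishing locus of one polynomial. The Gram determinants of the
    Stiefel factors equal [1], so they may be included in the product. *)
Lemma inWE U x : in_variety s U ->
  (inW s U x <-> \prod_j x 0 j * \prod_(i < k) \det ((U i)^T *m U i) != 0).
Proof.
move=> vU; rewrite mulf_eq0 negb_or; split=> [[h1 [h2 h3]]|/andP[/prodf_neq0 hx /prodf_neq0 hU]].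
  apply/andP; split; apply/prodf_neq0 => // i _.
  have [si|si] := ltnP i s; first by rewrite (h1 i si) det1 oner_neq0.
  by have [_ /eqP] := h2 i si; rewrite rank_gram.
split; [|split] => [i si|i si|j]; last exact: hx.
  by have := vU i; rewrite /fvar si.
split; first by have := vU i; rewrite /fvar ltnNge si.
by apply/eqP; rewrite rank_gram; exact: hU.
Qed.

Variable eps : {ffun 'I_k -> {ffun 'I_t -> bool}}.
Let cU := @chartU R k n s t eps.
Let cX := @chartX R k n s t.

Lemma inW_near z : inW s (cU z) (cX z) ->
  exists2 d, 0 < d & forall z', `|z' - z| < d -> inW s (cU z') (cX z').
Proof.
pose G z := \prod_j cX z 0 j * \prod_(i < k) \det ((cU z i)^T *m cU z i).
have vz y : in_variety s (cU y) by exact: chartU_in_variety.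
move/(inWE _ (vz z)) => Gz.
have rG : ratfun setT G.
  apply: ratfunM; first by apply: ratfun_prod => j _; exact: rat_mx_chartX.
  apply: ratfun_prod => i _; apply: ratfun_det; apply: rat_mxM.
    by apply: rat_mx_tr; exact: rat_mx_chartU.
  exact: rat_mx_chartU.
have Gz0 : 0 < `|G z| by rewrite normr_gt0.
have [d d0 h] := ratfun_modulus rG (Logic.I : setT z) Gz0.
exists d => // z' /(mx_norm_lt _ d0) hz; apply/(inWE _ (vz z')); apply/eqP => G0.
have : `|G z' - G z| < `|G z| by apply: h => i j; have := hz i j; rewrite !mxE.
by rewrite {1}/G G0 sub0r normrN ltxx.
Qed.

(** The chart is translated because [local_param] is centred at [0]. Injectivity, local surjectivity
    and continuity of the inverse are all read off from [chart_inv]; the radius comes from the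
    openness of [W]. *)
Lemma chart_local_param z : inW s (cU z) (cX z) ->
  exists delta, local_param s (cU z) (cX z) delta
    (fun i y => cU (z + y) i) (fun y => cX (z + y)).
Proof.
move=> Wz; have [d d0 hd] := inW_near Wz.
have DE y : ball (0 : 'rV[R]_(chart_dim n s t)) d y <-> `|y| < d by exact: ball0_norm.
have inDW y : `|y| < d -> inW s (cU (z + y)) (cX (z + y)).
  by move=> hy; apply: hd; rewrite addrAC subrr add0r.
have inv y : chart_inv s eps (cU y) (cX y) = y by exact: chart_invK.
have mod p e : 0 < e -> exists2 eta, 0 < eta & forall p',
    (forall i, `|cU p' i - cU p i| < eta) -> `|cX p' - cX p| < eta -> `|p' - p| < e.
  move=> e0; have dp : in_chart s eps (cU p) by exact: chartU_in_chart.
  have [eta eta0 h] := chart_inv_modulus (cX p) dp e0.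
  exists eta; first exact: eta0.
  move=> p' hU hx.
  have -> : p' - p = chart_inv s eps (cU p') (cX p') - chart_inv s eps (cU p) (cX p).
    by congr (_ - _); [exact: esym (inv p') | exact: esym (inv p)].
  exact: (h (cU p') (cX p') hU hx).
exists d; rewrite /local_param; cbv zeta.
split; first exact: d0.
split; first by move=> i; rewrite addr0.
split; first by rewrite addr0.
split; first by move=> y /DE; exact: inDW.
split.
  move=> y y' _ _ eU eX.
  have eU' : cU (z + y) = cU (z + y') by apply: functional_extensionality_dep => i; exact: eU.
  by apply: (addrI z); rewrite -[LHS]inv eU' eX inv.
split.
  have dz : in_chart s eps (cU z) by exact: chartU_in_chart.
  have [e1 e10 h1] := in_chart_near dz.
  have [e2 e20 h2] := chart_inv_modulus (cX z) dz d0.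
  (* [e1] keeps [U'] inside the chart, and [e2] keeps its chart coordinates inside the ball of
     radius [d]. *)
  exists (Num.min e1 e2); split; first by rewrite lt_min e10.
  move=> U' x' W' hU hx.
  have hU1 i : `|U' i - cU z i| < e1 by apply: lt_le_trans (hU i) _; rewrite ge_min lexx.
  have hU2 i : `|U' i - cU z i| < e2 by apply: lt_le_trans (hU i) _; rewrite ge_min lexx orbT.
  have hx2 : `|x' - cX z| < e2 by apply: lt_le_trans hx _; rewrite ge_min lexx orbT.
  have d' := h1 U' hU1; have v' := inW_in_variety W'.
  have ez : z + (chart_inv s eps U' x' - z) = chart_inv s eps U' x' by rewrite addrC subrK.
  exists (chart_inv s eps U' x' - z); rewrite ez.
  split; first by apply/DE; have := h2 U' x' hU2 hx2; rewrite inv.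
  by split=> [i|]; [exact: chartU_inv | exact: chartX_inv].
split.
  move=> y _ e e0; have [eta eta0 h] := mod (z + y) e e0.
  exists eta; split; first exact: eta0.
  move=> y' _ hU hx; have := h (z + y') hU hx.
  by have -> : z + y' - (z + y) = y' - y by rewrite opprD addrACA subrr add0r.
have rU := @rat_mx_chartU R k n s t tn n0 eps; have rX := @rat_mx_chartX R k n s t.
split; first by move=> i; apply: rat_mx_smooth; exact: (rat_mx_translate z (rU i)).
split; first by apply: rat_mx_smooth; exact: (rat_mx_translate z rX).
move=> c hU hX; apply: (@chart_immersion _ _ _ _ _ tn n0 eps z).
  move=> i a j; have E := derive_translated_mx z c a j (rU i).
  by rewrite -(etrans (esym (congr1 (fun M : 'M[R]_(n i, t) => M a j) (hU i))) E) mxE.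
move=> j; have E := derive_translated_mx z c 0 j rX.
by rewrite -(etrans (esym (congr1 (fun M : 'rV[R]_t => M 0 j) hX)) E) mxE.
Qed.

End LocalParam.

(** * Tangent vectors and KKT points *)

(** Distributivity over multi-indices: it makes the contraction of two rank-one tensors factor into
    scalar products. *)
Lemma sum_dffun_prod (R : realFieldType) (I : finType) (T : I -> finType)
    (f : forall i, T i -> R) :
  \sum_(m : {dffun forall i, T i}) \prod_i f i (m i) = \prod_i \sum_a f i a.
Proof.
rewrite (reindex (@dffun_of_fprod I T)); last exact/onW_bij/dffun_of_fprod_bij.
transitivity (\sum_(u : fprod T) \prod_(i in I) (finfun (f i)) (u i)).
  by apply: eq_bigr => u _; apply: eq_bigr => i _; rewrite !ffunE.
rewrite (big_fprod _ _ (fun i => finfun (f i))).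
transitivity (\prod_(i : I) \sum_(u in tagged_with T i) untag 0 (finfun (f i) : T i -> R) u).
  by rewrite bigA_distr_big_dep.
apply: eq_bigr => i _.
rewrite -(big_tag (fun i : I => (finfun (f i) : T i -> R)) i).
by apply: eq_bigr => a _; rewrite ffunE.
Qed.

Section TangentVectors.
Variables (R : realFieldType) (k : nat) (n : 'I_k -> nat) (t : nat).
Local Notation MIn := {dffun forall i : 'I_k, 'I_(n i)}.
Local Notation kpt := (forall i : 'I_k, 'M[R]_(n i, t)).
Variables (U dU : kpt) (x dx : 'rV[R]_t).

(** The differential of the sum of weighted rank-one tensors at [(U, x)] in direction [(dU, dx)],
    expanded by the product rule. *)
Definition tangent (m : MIn) : R :=
  \sum_j (dx 0 j * \prod_(i < k) U i (m i) j +
          x 0 j * \sum_(i < k) dU i (m i) j * \prod_(l < k | l != i) U l (m l) j).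

Definition pairing (Z : forall i, 'I_(n i) -> R) (V : kpt) i j : R :=
  \sum_a Z i a * V i a j.

Lemma contract_tangent (Z : forall i, 'I_(n i) -> R) :
  \sum_(m : MIn) (\prod_(i < k) Z i (m i)) * tangent m =
  \sum_j (dx 0 j * \prod_(i < k) pairing Z U i j +
    x 0 j * \sum_(i < k) pairing Z dU i j * \prod_(l < k | l != i) pairing Z U l j).
Proof.
rewrite /tangent; under eq_bigr do rewrite mulr_sumr.
rewrite exchange_big /=; apply: eq_bigr => j _.
under eq_bigr do rewrite mulrDr; rewrite big_split /=; congr (_ + _).
  rewrite -(sum_dffun_prod (fun i a => Z i a * U i a j)).
  rewrite big_distrr /=; apply: eq_bigr => m _.
  by rewrite mulrCA big_split.
rewrite (eq_bigr (fun m : MIn => x 0 j * \sum_i (\prod_l Z l (m l)) *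
    (dU i (m i) j * \prod_(l | l != i) U l (m l) j))); last first.
  by move=> m _; rewrite mulrCA; congr (_ * _); rewrite mulr_sumr.
rewrite -mulr_sumr exchange_big /=; congr (_ * _); apply: eq_bigr => i _.
transitivity (\prod_(l < k) \sum_a Z l a * (if l == i then dU l a j else U l a j)); last first.
  rewrite (bigD1 i) //= eqxx; congr (_ * _); apply: eq_bigr => l li.
  by rewrite (negbTE li).
rewrite -(sum_dffun_prod (fun l a => Z l a * (if l == i then dU l a j else U l a j))).
apply: eq_bigr => m _; rewrite big_split /=; congr (_ * _).
rewrite [in RHS](bigD1 i) //= eqxx; congr (_ * _); apply: eq_bigr => l li.
by rewrite (negbTE li).
Qed.

End TangentVectors.

Section Immersion.
Variables (R : realFieldType) (k : nat) (n : 'I_k -> nat) (t : nat).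
Hypothesis k3 : (3 <= k)%N.
Local Notation MIn := {dffun forall i : 'I_k, 'I_(n i)}.
Local Notation kpt := (forall i : 'I_k, 'M[R]_(n i, t)).
Variables (U dU : kpt) (x dx : 'rV[R]_t).

(** The point where [k >= 3] enters: with one factor left free and another one differentiated, a
    third factor remains to separate different columns. *)
Lemma third_index (i i' : 'I_k) : exists l : 'I_k, (l != i) && (l != i').
Proof.
have : (0 < #|~: [set i; i']|)%N.
  have := cardsC [set i; i']; rewrite card_ord cards2 => e.
  by case: (i != i') e => /=; lia.
by case/card_gt0P => l; rewrite !inE negb_or => h; exists l.
Qed.

Hypothesis rU : forall i, \rank (U i) = t.
Hypothesis nU : forall i j, \sum_a U i a j ^+ 2 = 1.
Hypothesis oU : forall i j, \sum_a U i a j * dU i a j = 0.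
Hypothesis x0 : forall j, x 0 j != 0.

(* Contracting a vanishing tangent vector with dual vectors of the [j0]-th columns in all factors
   but [i0] isolates the [j0]-th summand, since at least two factors remain. *)
Lemma tangent_immersion : (forall m : MIn, tangent U dU x dx m = 0) ->
  (forall i, dU i = 0) /\ dx = 0.
Proof.
move=> tan0.
have ex i : exists W : 'M[R]_(t, n i), W *m U i = 1%:M.
  have : row_free (U i)^T by rewrite /row_free mxrank_tr rU.
  by case/row_freeP => B UB; exists B^T; rewrite -[U i]trmxK -trmx_mul UB trmx1.
pose W i := projT1 (cid (ex i)); have hW i : W i *m U i = 1%:M := projT2 (cid (ex i)).
pose kappa i0 j := \sum_(i < k | i != i0) \sum_a W i j a * dU i a j.
have key (i0 : 'I_k) (j0 : 'I_t) (z : 'I_(n i0) -> R) :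
    dx 0 j0 * (\sum_a z a * U i0 a j0) + x 0 j0 * (\sum_a z a * dU i0 a j0 +
      kappa i0 j0 * \sum_a z a * U i0 a j0) = 0.
  pose Z := eqtype.dfwith (T := fun i => ('I_(n i) -> R)%type) (fun i a => W i j0 a) z.
  have Zin : Z i0 = z by rewrite /Z eqtype.dfwith_in.
  have Zout i j V : i != i0 -> pairing Z V i j = \sum_a W i j0 a * V i a j.
    by move=> ii0; rewrite /pairing /Z eqtype.dfwith_out // eq_sym.
  have ZU i j : i != i0 -> pairing Z U i j = (j0 == j)%:R.
    by move=> ii0; rewrite Zout //; have /matrixP/(_ j0 j) := hW i; rewrite !mxE.
  have pi0 V j : pairing Z V i0 j = \sum_a z a * V i0 a j by rewrite /pairing Zin.
  have := contract_tangent U dU x dx Z.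
  rewrite big1 => [|m _]; last by rewrite tan0 mulr0.
  move=> /esym E; rewrite -[RHS]E {E} (bigD1 j0) //= [X in _ = _ + X]big1 => [|j jj0].
    rewrite addr0; congr (_ * _ + _ * _).
      by rewrite [RHS](bigD1 i0) //= pi0 [X in _ * X]big1 ?mulr1 // => i ii0; rewrite ZU // eqxx.
    rewrite [RHS](bigD1 i0) //= pi0 [LHS]addrC [RHS]addrC; congr (_ + _).
      rewrite /kappa mulr_suml; apply: eq_bigr => i ii0; rewrite Zout //; congr (_ * _).
      rewrite [RHS](bigD1 i0) ?[i0 == i]eq_sym //= pi0 [X in _ * X]big1 ?mulr1 // => l /andP[_ l0].
      by rewrite ZU // eqxx.
    by rewrite [X in _ = _ * X]big1 ?mulr1 // => l l0; rewrite ZU // eqxx.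
  have z0 l : l != i0 -> pairing Z U l j = 0 by move=> l0; rewrite ZU // eq_sym (negbTE jj0).
  have [l /andP[l0 _]] := third_index i0 i0.
  rewrite [X in _ * X + _](bigD1 l) //= z0 // mul0r mulr0 add0r big1 ?mulr0 // => i _.
  have [l' /andP[li l'0]] := third_index i i0.
  by rewrite (bigD1 l') //= z0 // mul0r mulr0.
have dU0 i : dU i = 0.
  apply/matrixP => a0 j; rewrite mxE.
  (* Taking for [z] the column itself, of norm one and orthogonal to its derivative, gives
     [dx + x * kappa = 0]. A basis vector then leaves only [x * dU = 0]. *)
  have k1 := key i j (fun a => U i a j); have k2 := key i j (fun a => (a == a0)%:R).
  have s1 : \sum_a U i a j * U i a j = 1 by rewrite -[RHS](nU i j); apply: eq_bigr => a _; rewrite expr2.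
  have delta (V : 'M[R]_(n i, t)) : \sum_a (a == a0)%:R * V a j = V a0 j.
    by rewrite (bigD1 a0) //= eqxx mul1r big1 ?addr0 // => a /negbTE ->; rewrite mul0r.
  move: k1 k2; rewrite s1 oU !delta mulr1 add0r mulr1 => k1 k2.
  have : x 0 j * dU i a0 j = 0.
    rewrite -[RHS]k2 -[LHS]add0r -(mul0r (U i a0 j)) -k1; ring.
  by move/eqP; rewrite mulf_eq0 (negbTE (x0 j)) => /eqP.
split=> //; apply/rowP => j; rewrite mxE.
have i0 : 'I_k by apply: (@Ordinal _ 0); lia.
have := key i0 j (fun a => U i0 a j).
have s1 : \sum_a U i0 a j * U i0 a j = 1 by rewrite -[RHS](nU i0 j); apply: eq_bigr => a _; rewrite expr2.
rewrite s1 oU !mulr1 add0r /kappa big1 ?mulr0 ?addr0 // => i _.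
by rewrite big1 // => a _; rewrite dU0 mxE mulr0.
Qed.

End Immersion.

Lemma antisymmetric_sum (R : realFieldType) (t : nat) (c g : 'I_t -> 'I_t -> R) :
  (forall l j, c l j = c j l) -> (forall l j, g l j = - g j l) ->
  \sum_l \sum_j c l j * g l j = 0.
Proof.
move=> cs ga; have : \sum_l \sum_j c l j * g l j = - \sum_l \sum_j c l j * g l j.
  rewrite {1}exchange_big -sumrN; apply: eq_bigr => l _; rewrite -sumrN.
  by apply: eq_bigr => j _; rewrite cs ga mulrN.
by move/esym/eqP; rewrite eqNr => /eqP.
Qed.

Section Critical.
Variables (R : realType) (k : nat) (n : 'I_k -> nat) (s t : nat).
Hypotheses (s1 : (1 <= s)%N) (sk : (s <= k)%N).
Variables (A : tensor R n) (U dU : kpoint R n t) (dx : 'rV[R]_t).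
Let x : 'rV[R]_t := lamv A U.

Hypothesis kktU : KKT s A U.
Hypothesis skew : forall i : 'I_k, (i < s)%N -> forall l j,
  \sum_a U i a l * dU i a j = - \sum_a U i a j * dU i a l.
Hypothesis oU : forall i j, \sum_a U i a j * dU i a j = 0.

Lemma stiefel_gram (m : nat) (X : 'M[R]_(m, t)) l j : stiefel X ->
  \sum_a X a l * X a j = (l == j)%:R.
Proof.
move/matrixP/(_ l j); rewrite !mxE => e; rewrite -[RHS]e.
by apply: eq_bigr => a _; rewrite mxE.
Qed.

Lemma feasible_norm i j : \sum_a U i a j * U i a j = 1.
Proof.
have [[h1 h2] _] := kktU; have [si|si] := ltnP i s; first by rewrite stiefel_gram ?eqxx //; exact: h1.
by rewrite -[RHS](h2 i si j); apply: eq_bigr => a _; rewrite expr2.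
Qed.

Let i0 : 'I_k := Ordinal (leq_trans s1 sk).

Let gram0 l j : \sum_a U i0 a l * U i0 a j = (l == j)%:R.
Proof. by have [[h1 _] _] := kktU; apply: stiefel_gram; exact: h1. Qed.

Lemma tangent_data :
  \sum_(m : MI n) tangent U dU x dx m * A m =
  \sum_j (dx 0 j * x 0 j + x 0 j * \sum_i \sum_a Vmat A U i a j * dU i a j).
Proof.
under eq_bigr do rewrite mulr_suml.
rewrite exchange_big /=; apply: eq_bigr => j _.
rewrite (eq_bigr (fun m : MI n => dx 0 j * (A m * \prod_(i < k) U i (m i) j) +
   x 0 j * \sum_i (A m * (dU i (m i) j * \prod_(l < k | l != i) U l (m l) j)))); last first.
  move=> m _; rewrite -mulr_sumr mulrDl; congr (_ + _); by rewrite -mulrA [_ * A m]mulrC.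
rewrite big_split /= -!mulr_sumr; congr (_ * _ + _ * _); first by rewrite mxE.
rewrite exchange_big /=; apply: eq_bigr => i _.
rewrite (partition_big (fun m : MI n => m i) predT) //=; apply: eq_bigr => a _.
rewrite mxE mulr_suml; apply: eq_bigr => m /eqP <-.
by rewrite -mulrA; congr (_ * _); rewrite mulrC.
Qed.

(** The weights turn [V] into [V Lam], which the KKT equations rewrite. For [i < s] a symmetric [P]
    is paired with the skew matrix [U^T dU]; for the other factors each column of [V Lam] is a
    multiple of a column orthogonal to its derivative. *)
Lemma normal_component i : \sum_j x 0 j * \sum_a Vmat A U i a j * dU i a j = 0.
Proof.
have [_ [[P hP] [p hp]]] := kktU.
have VL a j : Vmat A U i a j * x 0 j = (Vmat A U i *m Lam A U) a j.
  by rewrite mul_mx_diag mxE.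
have -> : \sum_j x 0 j * \sum_a Vmat A U i a j * dU i a j =
   \sum_j \sum_a (Vmat A U i *m Lam A U) a j * dU i a j.
  apply: eq_bigr => j _; rewrite mulr_sumr; apply: eq_bigr => a _.
  by rewrite -VL; ring.
have [si|si] := ltnP i s.
  have [Psym ->] := hP i si.
  have -> : \sum_j \sum_a (U i *m P i) a j * dU i a j =
     \sum_l \sum_j P i l j * \sum_a U i a l * dU i a j.
    rewrite [RHS]exchange_big; apply: eq_bigr => j _.
    under [RHS]eq_bigr do rewrite mulr_sumr.
    rewrite [RHS]exchange_big; apply: eq_bigr => a _; rewrite mxE mulr_suml.
    by apply: eq_bigr => l _; ring.
  apply: antisymmetric_sum => [l j|l j]; last exact: skew.
  by rewrite -{1}Psym mxE.
rewrite (hp i si) big1 // => j _.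
rewrite (eq_bigr (fun a => p 0 j * (U i a j * dU i a j))) => [|a _].
  by rewrite -mulr_sumr oU mulr0.
by rewrite mul_mx_diag mxE; ring.
Qed.

(** Cross terms vanish in three ways. Those with [dx] contain a scalar product of different columns
    of the orthonormal factor [i0]. In a factor [i < s], coefficients symmetric in the two columns
    meet the skew [U^T dU]. In a factor [i >= s], the diagonal vanishes by [oU] and the rest again
    by [i0], which differs from [i]. *)
Lemma tangent_model :
  \sum_(m : MI n) tangent U dU x dx m * (\sum_j x 0 j * \prod_(i < k) U i (m i) j) =
  \sum_j dx 0 j * x 0 j.
Proof.
under eq_bigr do rewrite mulr_sumr.
rewrite exchange_big /=.
have E l : \sum_(m : MI n) tangent U dU x dx m * (x 0 l * \prod_(i < k) U i (m i) l) =
    x 0 l * (dx 0 l + \sum_j x 0 j * \sum_(i < k) (\sum_a U i a l * dU i a j) *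
        \prod_(q < k | q != i) \sum_a U q a l * U q a j).
  rewrite (eq_bigr (fun m : MI n => x 0 l *
     ((\prod_(i < k) (fun a => U i a l) (m i)) * tangent U dU x dx m))); last first.
    by move=> m _; rewrite mulrCA; congr (_ * _); rewrite mulrC.
  rewrite -mulr_sumr; congr (_ * _).
  apply: (etrans (contract_tangent U dU x dx (fun i a => U i a l))).
  rewrite big_split /=; congr (_ + _).
  rewrite (bigD1 l) //= big1 ?mulr1 => [|i _]; last exact: feasible_norm.
  rewrite big1 ?addr0 // => j jl; rewrite (bigD1 i0) //= /pairing gram0 eq_sym.
  by rewrite (negbTE jl) mul0r mulr0.
rewrite (eq_bigr _ (fun l _ => E l)).
under eq_bigr do rewrite mulrDr; rewrite big_split /= [X in _ + X](_ : _ = 0) ?addr0.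
  by apply: eq_bigr => l _; rewrite mulrC.
transitivity (\sum_i \sum_l \sum_j (x 0 l * x 0 j * \prod_(q < k | q != i) \sum_a U q a l * U q a j) *
   \sum_a U i a l * dU i a j).
  rewrite [RHS]exchange_big; apply: eq_bigr => l _; rewrite mulr_sumr [RHS]exchange_big.
  apply: eq_bigr => j _; rewrite !mulr_sumr; apply: eq_bigr => i _; ring.
rewrite big1 // => i _; have [si|si] := ltnP i s.
  apply: antisymmetric_sum => [l j|l j]; last exact: skew.
  rewrite [x 0 l * _]mulrC; congr (_ * _); apply: eq_bigr => q _.
  by apply: eq_bigr => a _; rewrite mulrC.
rewrite big1 // => l _; rewrite big1 // => j _.
have [<-|lj] := eqVneq l j; first by rewrite oU mulr0.
rewrite (bigD1 i0) /=; first by rewrite gram0 (negbTE lj) mul0r mulr0 mul0r.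
by apply: contraTneq si => <-; rewrite -ltnNge.
Qed.

(* At [x = lam] the residual tensor annihilates every tangent vector: this is the Lagrange
   multiplier rule read on the parametrized manifold. *)
Lemma kkt_critical :
  \sum_(m : MI n) tangent U dU x dx m * (A m - \sum_j x 0 j * \prod_(i < k) U i (m i) j) = 0.
Proof.
under eq_bigr do rewrite mulrBr; rewrite sumrB tangent_data tangent_model big_split /=.
rewrite addrAC subrr add0r.
under eq_bigr do rewrite mulr_sumr.
by rewrite exchange_big /= big1 // => i _; exact: normal_component.
Qed.

End Critical.

(** * From KKT points to primitive KKT points *)

Section Reduction.
Variables (R : realType) (k : nat) (n : 'I_k -> nat) (s r : nat).
Variables (A : tensor R n) (U : kpoint R n r).
Hypothesis kktU : KKT s A U.

Let J := nzcols A U.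
Let e (j : 'I_#|J|) : 'I_r := enum_val j.
Let U' : kpoint R n #|J| := fun i => colsub e (U i).

Let lamE j : lam A U' j = lam A U (e j).
Proof.
apply: eq_bigr => m _; congr (_ * _); apply: eq_bigr => i _; by rewrite mxE.
Qed.

Let VmatE i a j : Vmat A U' i a j = Vmat A U i a (e j).
Proof.
rewrite !mxE; apply: eq_bigr => m _; congr (_ * _); apply: eq_bigr => l _; by rewrite mxE.
Qed.

Lemma reduce_primitive : primitive A U'.
Proof. by move=> j; rewrite lamE; have := enum_valP j; rewrite inE. Qed.

Lemma reduce_KKT : KKT s A U'.
Proof.
have [[hS hO] [[P hP] [p hp]]] := kktU.
have VL i a j : (Vmat A U' i *m Lam A U') a j = (Vmat A U i *m Lam A U) a (e j).
  rewrite !mul_mx_diag mxE [RHS]mxE VmatE; congr (_ * _).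
  by rewrite !mxE lamE.
have stU i : stiefel (U i) -> stiefel (U' i).
  move=> h; apply/matrixP => l j; rewrite !mxE.
  have := stiefel_gram (e l) (e j) h.
  rewrite (inj_eq enum_val_inj) => <-; apply: eq_bigr => a _; by rewrite !mxE.
split; [split|split].
- by move=> i si; apply: stU; exact: hS.
- move=> i si j; rewrite -[RHS](hO i si (e j)); apply: eq_bigr => a _; by rewrite mxE.
- exists (fun i => mxsub e e (P i)) => i si; have [Psym VP] := hP i si.
  split; first by rewrite -{2}Psym; apply/matrixP => l j; rewrite !mxE.
  apply/matrixP => a j; rewrite VL VP mxE [RHS]mxE.
  (* Columns outside [J] have zero multipliers, because [P = U^T V Lam]. *)
  have P0 l : l \notin J -> P i l (e j) = 0.
    move=> lJ; rewrite -Psym mxE.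
    have -> : P i = (U i)^T *m (Vmat A U i *m Lam A U) by rewrite VP mulmxA (hS i si) mul1mx.
    rewrite mxE big1 // => b _; rewrite mul_mx_diag [X in _ * X]mxE.
    move: lJ; rewrite inE negbK [lamv _ _ _ _]mxE => /eqP ->; by rewrite !mulr0.
  rewrite (bigID (mem J)) /= [X in _ + X]big1 ?addr0 => [|l /P0 ->]; last by rewrite mulr0.
  rewrite big_enum_val; apply: eq_bigr => l _; by rewrite !mxE.
- exists (\row_j p 0 (e j)) => i si; apply/matrixP => a j.
  by rewrite VL hp // !mul_mx_diag !mxE.
Qed.

Lemma reduce_size : (#|J| <= r)%N.
Proof. by rewrite -[X in (_ <= X)%N]card_ord max_card. Qed.

End Reduction.

Lemma smooth_essential_primitive (R : realType) (k : nat) (n : 'I_k -> nat) (s r : nat)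
    (A : tensor R n) (t : nat) (U : kpoint R n t) :
  smooth_essential s A r (existT (kpoint R n) t U) ->
  [/\ (t <= r)%N, KKT s A U, primitive A U & smooth_pt s U].
Proof.
move=> [V [kV [eV sm]]]; move: sm => /= sm.
(* The claim is phrased for the dependent pair, so that it can be rewritten along the equality of
   pairs although [t] is part of the pair. *)
pose Q (P : {t' : nat & kpoint R n t'}) :=
  [/\ (tag P <= r)%N, KKT s A (projT2 P) & primitive A (projT2 P)].
suff : Q (existT (kpoint R n) t U) by case.
rewrite -eV; split; [exact: reduce_size | exact: reduce_KKT | exact: reduce_primitive].
Qed.

Section DeriveProducts.
Variables (R : realType) (V : normedModType R) (z c : V).

Lemma is_derive_bigsum (I : Type) (r : seq I) (f : I -> V -> R) (df : I -> R) :
  (forall i, is_derive z c (f i) (df i)) ->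
  is_derive z c (fun y => \sum_(i <- r) f i y) (\sum_(i <- r) df i).
Proof.
move=> h; elim: r => [|i r IH].
  rewrite big_nil (_ : (fun y => _) = cst 0); first exact: is_derive_cst.
  by apply/funext => y; rewrite big_nil.
rewrite big_cons (_ : (fun y => _) = f i + (fun y => \sum_(j <- r) f j y)).
  exact: is_deriveD.
by apply/funext => y; rewrite big_cons.
Qed.

Lemma is_derive_prod (I : finType) (f : I -> V -> R) (df : I -> R) :
  (forall i, is_derive z c (f i) (df i)) ->
  is_derive z c (fun y => \prod_i f i y) (\sum_i df i * \prod_(l | l != i) f l z).
Proof.
(* On a sequence without repetitions, the condition [l != i] removes exactly the differentiated
   factor. *)
move=> h; suff H (r : seq I) : uniq r -> is_derive z c (fun y => \prod_(i <- r) f i y)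
    (\sum_(i <- r) df i * \prod_(l <- r | l != i) f l z).
  by apply: H; exact: index_enum_uniq.
elim: r => [_|i r IH /= /andP[ir ur]].
  rewrite big_nil (_ : (fun y => _) = cst 1); first exact: is_derive_cst.
  by apply/funext => y; rewrite big_nil.
rewrite (_ : (fun y => _) = f i * (fun y => \prod_(j <- r) f j y)); last first.
  by apply/funext => y; rewrite big_cons.
apply: (is_derive_eq (is_deriveM (h i) (IH ur))).
rewrite big_cons /= big_cons eqxx /= addrC /GRing.scale /=; congr (_ + _).
  rewrite mulrC; congr (_ * _); rewrite big_seq [RHS]big_seq_cond; apply: eq_bigl => l.
  by case: eqP => [->|]; rewrite ?(negbTE ir) ?andbT.
rewrite mulr_sumr big_seq [RHS]big_seq; apply: eq_bigr => l lr.
rewrite big_cons; case: eqP lr => [<-|_ _]; first by rewrite (negbTE ir).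
by rewrite mulrCA.
Qed.

End DeriveProducts.

Lemma hessian_translate (R : realType) (d : nat) (G : 'rV[R]_d -> R) z :
  \matrix_(a < d, b < d) 'D_(evec R a) ('D_(evec R b) (fun y => G (z + y))) 0 =
  \matrix_(a < d, b < d) 'D_(evec R a) ('D_(evec R b) G) z.
Proof.
apply/matrixP => a b; rewrite !mxE.
have -> : 'D_(evec R b) (fun y => G (z + y)) = (fun y => 'D_(evec R b) G (z + y)).
  by apply/funext => y; rewrite derive_translate.
rewrite -[in RHS](addr0 z).
exact: (derive_translate ('D_(evec R b) G) z 0 (evec R a)).
Qed.

(** * The tensor family in a chart, and the final assembly *)

Section TensorFamily.
Variables (R : realType) (k : nat) (n : 'I_k -> nat) (s t : nat).
Hypotheses (k3 : (3 <= k)%N) (s1 : (1 <= s)%N) (sk : (s <= k)%N).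
Hypotheses (tn : forall i, (t <= n i)%N) (n0 : forall i, (0 < n i)%N).
Variable eps : {ffun 'I_k -> {ffun 'I_t -> bool}}.
Let d := chart_dim n s t.
Let cU : 'rV[R]_d -> kpoint R n t := @chartU R k n s t eps.
Let cX : 'rV[R]_d -> 'rV[R]_t := @chartX R k n s t.

Definition rank_one_sum (m : MI n) (z : 'rV[R]_d) : R :=
  \sum_j cX z 0 j * \prod_(i < k) cU z i (m i) j.

Let hU i : rat_mx setT (fun z => cU z i).
Proof. exact: rat_mx_chartU. Qed.

Let hX : rat_mx setT cX.
Proof. exact: rat_mx_chartX. Qed.

Lemma ratfun_rank_one_sum m : ratfun setT (rank_one_sum m).
Proof.
apply: ratfun_sum => j _; apply: ratfunM; first exact: hX.
by apply: ratfun_prod => i _; exact: hU.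
Qed.

Definition dchartU z c : kpoint R n t := fun i => \matrix_(a, j) 'D_c (fun y => cU y i a j) z.
Definition dchartX z c : 'rV[R]_t := \row_j 'D_c (fun y => cX y 0 j) z.

Let derU z c i a j : is_derive z c (fun y => cU y i a j) (dchartU z c i a j).
Proof. by rewrite mxE; apply: DeriveDef => //; exact: (ratfun_derivable (@hU i a j)). Qed.

Let derX z c j : is_derive z c (fun y => cX y 0 j) (dchartX z c 0 j).
Proof. by rewrite mxE; apply: DeriveDef => //; exact: (ratfun_derivable (hX 0 j)). Qed.

Lemma derive_rank_one_sum m z c :
  'D_c (rank_one_sum m) z = tangent (cU z) (dchartU z c) (cX z) (dchartX z c) m.
Proof.
have h : is_derive z c (rank_one_sum m) (tangent (cU z) (dchartU z c) (cX z) (dchartX z c) m).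
  apply: is_derive_bigsum => j.
  have hp := is_derive_prod (fun i : 'I_k => derU z c (m i) j).
  apply: (is_derive_eq (is_deriveM (derX z c j) hp)).
  by rewrite /GRing.scale /= addrC [X in X + _]mulrC.
exact: derive_val.
Qed.

(** The orthonormality and norm constraints hold identically in the chart; differentiating them
    yields the tangency conditions used for the immersion and for KKT points. *)
Lemma derive_const_gram (I : finType) (F G : I -> 'rV[R]_d -> R) z c C
   (dF dG : I -> R) :
  (forall i, is_derive z c (F i) (dF i)) -> (forall i, is_derive z c (G i) (dG i)) ->
  (forall y, \sum_i F i y * G i y = C) -> \sum_i (F i z * dG i + G i z * dF i) = 0.
Proof.
move=> hF hG e.
have h : is_derive z c (fun y => \sum_i F i y * G i y) (\sum_i (F i z * dG i + G i z * dF i)).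
  by apply: is_derive_bigsum => i; exact: is_deriveM.
rewrite -(@derive_val _ _ _ _ _ _ _ h) (_ : (fun y => _) = cst C) ?derive_cst //.
by apply/funext => y; rewrite e.
Qed.

Let vz z : in_variety s (cU z).
Proof. exact: chartU_in_variety. Qed.

Lemma dchart_skew z c (i : 'I_k) : (i < s)%N -> forall l j,
  \sum_a cU z i a l * dchartU z c i a j = - \sum_a cU z i a j * dchartU z c i a l.
Proof.
move=> si l j; apply/eqP; rewrite -addr_eq0 -big_split /=; apply/eqP.
apply: (@derive_const_gram _ (fun a y => cU y i a l) (fun a y => cU y i a j) z c (l == j)%:R) => [a|a|y].
- exact: derU.
- exact: derU.
by apply: stiefel_gram; have := vz y i; rewrite /fvar si.
Qed.

Lemma chart_norm z i j : \sum_a cU z i a j * cU z i a j = 1.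
Proof.
have := vz z i; rewrite /fvar; case: ifP => [_ h|_ /(_ j) h].
  by rewrite stiefel_gram ?eqxx.
by rewrite -[RHS]h; apply: eq_bigr => a _; rewrite expr2.
Qed.

Lemma dchart_orth z c i j : \sum_a cU z i a j * dchartU z c i a j = 0.
Proof.
have := @derive_const_gram _ (fun a y => cU y i a j) (fun a y => cU y i a j) z c 1
  _ _ (fun a => derU z c a j) (fun a => derU z c a j) (fun y => chart_norm y i j).
rewrite big_split /= => /eqP; rewrite -mulr2n mulrn_eq0 /= => /eqP //.
Qed.

Lemma inW_rank z i : inW s (cU z) (cX z) -> \rank (cU z i) = t.
Proof.
move=> [h1 [h2 _]]; have [si|si] := ltnP i s; last by have [] := h2 i si.
by apply/eqP; rewrite rank_gram (h1 i si) det1 oner_neq0.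
Qed.

Lemma rank_one_sum_immersion z (c : 'rV[R]_d) : inW s (cU z) (cX z) ->
  (forall m, \sum_b c 0 b * 'D_(evec R b) (rank_one_sum m) z = 0) -> c = 0.
Proof.
move=> Wz h; have [h1 [h2 h3]] := Wz.
have [dU0 dX0] : (forall i, dchartU z c i = 0) /\ dchartX z c = 0.
  apply: (@tangent_immersion _ _ _ _ k3 (cU z) _ (cX z)) => //.
  - by move=> i; exact: inW_rank.
  - by move=> i j; rewrite -[RHS](chart_norm z i j); apply: eq_bigr => a _; rewrite expr2.
  - by move=> i j; exact: dchart_orth.
  - move=> m; rewrite -derive_rank_one_sum (row_evec c).
    by rewrite (ratfun_derive_linear _ _ (ratfun_rank_one_sum m)).
apply: (@chart_immersion _ _ _ _ _ tn n0 eps z) => [i a j|j].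
  by have /matrixP/(_ a j) := dU0 i; rewrite !mxE.
by have /rowP/(_ j) := dX0; rewrite !mxE.
Qed.

Lemma kkt_crit_points A z : KKT s A (cU z) -> cX z = lamv A (cU z) -> inW s (cU z) (cX z) ->
  crit_points rank_one_sum A z.
Proof.
move=> kz xz Wz; split=> [b|c]; last exact: rank_one_sum_immersion.
have := @kkt_critical _ _ _ _ _ s1 sk A (cU z) (dchartU z (evec R b)) (dchartX z (evec R b)) kz
  (fun i si => dchart_skew z (evec R b) si) (fun i j => dchart_orth z (evec R b) i j).
rewrite -xz => e; rewrite -[RHS]e; apply: eq_bigr => m _.
by rewrite derive_rank_one_sum.
Qed.

Lemma crit_points_nondegenerate A z : cX z = lamv A (cU z) -> inW s (cU z) (cX z) ->
  (forall b, 'D_(evec R b) (half_sqdist rank_one_sum A) z = 0) ->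
  \matrix_(a < d, b < d) 'D_(evec R a) ('D_(evec R b) (half_sqdist rank_one_sum A)) z \in unitmx ->
  nondegenerate_kkt s A (cU z).
Proof.
move=> xz Wz D1 D2; rewrite /nondegenerate_kkt -xz; split=> //.
have [delta lp] := chart_local_param tn n0 Wz.
exists d, delta, (fun i y => cU (z + y) i), (fun y => cX (z + y)); split; first exact: lp.
have eG : (fun y : 'rV[R]_d => gfun A (fun i => cU (z + y) i) (cX (z + y))) =
   (fun y => half_sqdist rank_one_sum A (z + y)) by [].
cbv zeta; rewrite eG; split=> [a|]; first by rewrite derive_translate addr0.
by rewrite hessian_translate.
Qed.

End TensorFamily.

(** The signs are chosen separately in each factor to make its denominator nonzero. Membership in
    [W] combines the constraints, smoothness of the point and, for the weights, primitivity. *)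
Lemma kkt_in_some_chart (R : realType) (k : nat) (n : 'I_k -> nat) (s t : nat)
    (A : tensor R n) (U : kpoint R n t) :
  (forall i, (t <= n i)%N) -> (forall i, (0 < n i)%N) ->
  KKT s A U -> primitive A U -> smooth_pt s U ->
  exists (eps : {ffun 'I_k -> {ffun 'I_t -> bool}}) (z : 'rV[R]_(chart_dim n s t)),
    [/\ U = chartU eps z, chartX z = lamv A (chartU eps z) & inW s (chartU eps z) (chartX z)].
Proof.
move=> tn n0 kU pU sU.
have /choice[eps heps] : forall i : 'I_k, exists eps : {ffun 'I_t -> bool},
    fden (i < s)%N eps (U i) != 0.
  by move=> i; exact: exists_fden.
have WU : inW s U (lamv A U).
  have [[h1 h2] _] := kU; split; [exact: h1 | split=> // j].
  by rewrite mxE; exact: pU.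
pose e : {ffun 'I_k -> {ffun 'I_t -> bool}} := [ffun i => eps i].
have dU : in_chart s e U by move=> i; rewrite ffunE; exact: heps.
have vU := inW_in_variety WU.
exists e, (chart_inv s e U (lamv A U)).
have eU : chartU e (chart_inv s e U (lamv A U)) = U.
  by apply: functional_extensionality_dep => i; exact: chartU_inv.
by rewrite eU chartX_inv; split.
Qed.

Theorem theorem4p7 (R : realType) (k : nat) (n : 'I_k -> nat) (s r : nat) :
  (3 <= k)%N -> (1 <= s <= k)%N -> (forall i, 0 < n i)%N ->
  (0 < r)%N -> (forall i, r <= n i)%N ->
  exists N : set (tensor R n),
    lebesgue_null N /\
    forall A : tensor R n, ~ N A ->
      finite_set (smooth_essential s A r) /\
      (forall t : nat, (0 < t <= r)%N ->
        forall U' : kpoint R n t,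
          KKT s A U' -> primitive A U' -> smooth_pt s U' ->
          smooth_essential s A r (existT (kpoint R n) t U') ->
          nondegenerate_kkt s A U').
Proof.
move=> k3 /andP[s1 sk] n0 _ rn.
pose i0 : MI n := finfun (fun i => Ordinal (n0 i)).
(* All sizes up to [r] and all signs give finitely many families. Size [0] is included, since the
   reduction may delete every column. *)
pose idx : finType := {t : 'I_r.+1 & {ffun 'I_k -> {ffun 'I_t -> bool}}}.
have tn (t : 'I_r.+1) i : (t <= n i)%N by apply: leq_trans (rn i); rewrite -ltnS.
pose fam (u : idx) := @rank_one_sum R k n s (tag u) (tagged u).
have hfam (u : idx) m : ratfun setT (fam u m) by exact: ratfun_rank_one_sum (tn _) n0 _ _.
have /choice[S hS] := fun u : idx => generic_morse (hfam u) i0.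
exists [set A | exists u : idx, S u A]; split.
  by apply: (null_bigcup i0) => u; case: (hS u).
move=> A nA.
have gen (u : idx) := (hS u).2 A (fun SA => nA (ex_intro _ u SA)).
have chart t (U : kpoint R n t) : (t <= r)%N -> KKT s A U -> primitive A U -> smooth_pt s U ->
    exists (u : idx) (z : 'rV[R]_(chart_dim n s (tag u))),
      existT (kpoint R n) t U = existT (kpoint R n) (tag u : nat) (chartU (tagged u) z) /\
      crit_points (fam u) A z /\
      (KKT s A (chartU (tagged u) z) -> nondegenerate_kkt s A (chartU (tagged u) z)).
  move=> tr kU pU sU; have tn' i : (t <= n i)%N by exact: leq_trans tr (rn i).
  have [eps [z [eU xz Wz]]] := kkt_in_some_chart tn' n0 kU pU sU.
  move: kU pU sU; rewrite eU => kU _ _.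
  have tr' : (t < r.+1)%N by [].
  exists (Tagged (fun t : 'I_r.+1 => {ffun 'I_k -> {ffun 'I_t -> bool}}) (eps : {ffun 'I_k -> {ffun 'I_(Ordinal tr') -> bool}})), z.
  have cz := kkt_crit_points k3 s1 sk tn' n0 kU xz Wz.
  split; first by [].
  split; first exact: cz.
  move=> _; have [_ h] := gen (Tagged (fun t : 'I_r.+1 => {ffun 'I_k -> {ffun 'I_t -> bool}}) (eps : {ffun 'I_k -> {ffun 'I_(Ordinal tr') -> bool}})).
  have [h1 h2] := h z cz.
  exact: (crit_points_nondegenerate tn' n0 xz Wz h1 h2).
split.
  (* An essential point is represented by its primitive point, and each of these is the image of a
     critical point in one of finitely many charts. *)
  apply: (@sub_finite_set _ _ (\bigcup_(u in [set: idx])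
     ((fun z => existT (kpoint R n) (tag u : nat) (chartU (tagged u) z)) @` crit_points (fam u) A))).
    move=> [t U] /smooth_essential_primitive[tr kU pU sU].
    have [u [z [-> [cz _]]]] := chart t U tr kU pU sU.
    by exists u => //; exists z.
  apply: bigcup_finite; first exact: finite_finset.
  by move=> u _; apply: finite_image; case: (gen u).
move=> t /andP[_ tr] U kU pU sU _.
have tn' i : (t <= n i)%N by exact: leq_trans tr (rn i).
have [u [z [e [_ nd]]]] := chart t U tr kU pU sU.
pose Q (P : {t' : nat & kpoint R n t'}) :=
  KKT s A (projT2 P) -> nondegenerate_kkt s A (projT2 P).
suff : Q (existT (kpoint R n) t U) by apply.
by rewrite e.
Qed.
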